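(* The logics $\mathbf{CL}$, $\mathbf{CLM}$, $\mathbf{IL}$, $\mathbf{ILM}$, $\mathbf{ILP}$ and $\mathbf{ILW}$ are topologically complete: for each such logic $L$ and every formula $\varphi$, if $\varnothing\models_L^T\varphi$ then $\varphi\in L$.
   Context: The language $\mathcal{L}(\Box,\rhd)$ has countably many propositional variables, $\top,\bot$, $\neg,\land,\lor,\to$, unary $\Box,\Diamond$ ($\Diamond$ dual of $\Box$) and binary $\rhd$. $\mathbf{CL}$ is the smallest set of formulas containing all propositional tautologies, $\Box(p\to q)\to(\Box p\to\Box q)$, $\Box(\Box p\to p)\to\Box p$, J1: $\Box(p\to q)\to(p\rhd q)$; J2: $(p\rhd q)\land(q\rhd r)\to(p\rhd r)$; J3: $(p\rhd r)\land(q\rhd r)\to((p\lor q)\rhd r)$; J4: $(p\rhd q)\to(\Diamond p\to\Diamond q)$, closed under modus ponens, necessitation and substitution. A normal extension of $\mathbf{CL}$ is a superset closed under these rules; $L+\chi$ is the smallest normal extension of $L$ containing $\chi$. J5: $\Diamond p\rhd p$; M: $(p\rhd q)\to((p\land\Box r)\rhd(q\land\Box r))$; P: $(p\rhd q)\to\Box(p\rhd q)$; W: $(p\rhd q)\to(p\rhd(q\land\Box\neg p))$. $\mathbf{CLM}=\mathbf{CL}+\mathrm{M}$, $\mathbf{IL}=\mathbf{CL}+\mathrm{J5}$, $\mathbf{ILM}=\mathbf{IL}+\mathrm{M}$, $\mathbf{ILP}=\mathbf{IL}+\mathrm{P}$, $\mathbf{ILW}=\mathbf{IL}+\mathrm{W}$.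 For a topology $\tau$ on $X$, $d_\tau(Y)=\{x: \text{every } U\in\tau \text{ containing } x \text{ meets } Y\setminus\{x\}\}$, $cd_\tau(Y)=X\setminus d_\tau(X\setminus Y)$. A bitopological space is $\langle X,\tau^0,\tau^1\rangle$, $X\ne\varnothing$, $\tau^0,\tau^1$ topologies. $e_{\tau^0,\tau^1}(Y,Z)=\{x:\forall U\in\tau^1[x\in d_{\tau^0}(Y\cap U)\Rightarrow x\in d_{\tau^0}(Z\cap U)]\}$. A valuation $v$ maps formulas to subsets of $X$, Boolean on connectives, with $v(\Box\varphi)=cd_{\tau^0}(v(\varphi))$, $v(\Diamond\varphi)=d_{\tau^0}(v(\varphi))$, $v(\varphi\rhd\psi)=e_{\tau^0,\tau^1}(v(\varphi),v(\psi))$. $\mathrm{Log}(X,\tau^0,\tau^1)$ is the set of formulas $\varphi$ with $v(\varphi)=X$ for all $v$; an $L$-space satisfies $L\subseteq\mathrm{Log}(X,\tau^0,\tau^1)$. $\varnothing\models_L^T\varphi$ means $\varphi$ is valid in every $L$-space. *)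

(* Defs.v *)
From HB Require Import structures.
From mathcomp Require Import all_boot.
From mathcomp Require Import boolp classical_sets.
From mathcomp Require Import topology_structure.

Set Implicit Arguments.
Unset Strict Implicit.
Unset Printing Implicit Defensive.

Local Open Scope classical_set_scope.

Inductive formula : Type :=
| Var of nat
| Top
| Bot
| Neg of formula
| And of formula & formula
| Or of formula & formula
| Imp of formula & formula
| Box of formula
| Rhd of formula & formula.

(* The diamond is an abbreviation rather than a constructor; [val_Dia] below
   gives its topological reading. *)
Definition Dia (a : formula) : formula := Neg (Box (Neg a)).

Fixpoint subst (s : nat -> formula) (a : formula) : formula :=
  match a with
  | Var n => s n
  | Top => Top
  | Bot => Bot
  | Neg b => Neg (subst s b)
  | And b c => And (subst s b) (subst s c)
  | Or b c => Or (subst s b) (subst s c)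
  | Imp b c => Imp (subst s b) (subst s c)
  | Box b => Box (subst s b)
  | Rhd b c => Rhd (subst s b) (subst s c)
  end.

(* [t] assigns truth values to the formulas treated as propositional atoms:
   the variables and the formulas headed by [Box] or [Rhd]. *)
Fixpoint bool_eval (t : formula -> bool) (a : formula) : bool :=
  match a with
  | Top => true
  | Bot => false
  | Neg b => ~~ bool_eval t b
  | And b c => bool_eval t b && bool_eval t c
  | Or b c => bool_eval t b || bool_eval t c
  | Imp b c => bool_eval t b ==> bool_eval t c
  | Var _ | Box _ | Rhd _ _ => t a
  end.

Definition tautology : set formula :=
  [set a | forall t : formula -> bool, bool_eval t a].

Section Schemes.
Let p := Var 0.
Let q := Var 1.
Let r := Var 2.

Definition axK := Imp (Box (Imp p q)) (Imp (Box p) (Box q)).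
Definition axL := Imp (Box (Imp (Box p) p)) (Box p).
Definition axJ1 := Imp (Box (Imp p q)) (Rhd p q).
Definition axJ2 := Imp (And (Rhd p q) (Rhd q r)) (Rhd p r).
Definition axJ3 := Imp (And (Rhd p r) (Rhd q r)) (Rhd (Or p q) r).
Definition axJ4 := Imp (Rhd p q) (Imp (Dia p) (Dia q)).
Definition axJ5 := Rhd (Dia p) p.
Definition axM := Imp (Rhd p q) (Rhd (And p (Box r)) (And q (Box r))).
Definition axP := Imp (Rhd p q) (Box (Rhd p q)).
Definition axW := Imp (Rhd p q) (Rhd p (And q (Box (Neg p)))).
End Schemes.

Definition closed_rules (L : set formula) : Prop :=
  [/\ forall a b, L (Imp a b) -> L a -> L b,
      forall a, L a -> L (Box a)
    & forall s a, L a -> L (subst s a)].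

Definition CL : set formula :=
  smallest closed_rules
    (tautology `|` [set axK] `|` [set axL] `|` [set axJ1] `|` [set axJ2]
               `|` [set axJ3] `|` [set axJ4]).

Definition normal_extension (L : set formula) : Prop :=
  CL `<=` L /\ closed_rules L.

Definition add_axiom (L : set formula) (c : formula) : set formula :=
  smallest normal_extension (L `|` [set c]).

Definition CLM := add_axiom CL axM.
Definition IL := add_axiom CL axJ5.
Definition ILM := add_axiom IL axM.
Definition ILP := add_axiom IL axP.
Definition ILW := add_axiom IL axW.

(* [Topological X] is the type of topologies on [X], i.e. of the structures
   that turn [X] into a [topologicalType]. *)
Record bitop_space : Type := BitopSpace {
  carrier :> Type;
  carrier_nonempty : [set: carrier] !=set0;
  tau0 : Topological carrier;
  tau1 : Topological carrier
}.

Section Operators.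
Variable X : Type.

Definition topen (t : Topological X) (U : set X) : Prop :=
  @open (Topological.Pack t) U.

Definition der (t : Topological X) (Y : set X) : set X :=
  @limit_point (Topological.Pack t) Y.

Definition coder (t : Topological X) (Y : set X) : set X := ~` der t (~` Y).

Definition erhd (t0 t1 : Topological X) (Y Z : set X) : set X :=
  [set x | forall U, topen t1 U -> der t0 (Y `&` U) x -> der t0 (Z `&` U) x].

Lemma derE (t : Topological X) (Y : set X) :
  der t Y = [set x | forall U, topen t U -> U x -> U `&` (Y `\ x) !=set0].
Proof.
apply/seteqP; split => x /= dx U.
  move=> oU Ux.
  have [|y [/eqP yx Yy Uy]] := dx U; last by exists y.
  exact: (@open_nbhs_nbhs (Topological.Pack t) x U (conj oU Ux)).
rewrite (@nbhsE (Topological.Pack t)) => -[V [oV Vx] VU].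
have [y [Vy [Yy yx]]] := dx V oV Vx.
by exists y; split=> //; [apply/eqP | apply: VU].
Qed.

End Operators.

Fixpoint val (S : bitop_space) (v : nat -> set S) (a : formula) : set S :=
  match a with
  | Var n => v n
  | Top => setT
  | Bot => set0
  | Neg b => ~` val v b
  | And b c => val v b `&` val v c
  | Or b c => val v b `|` val v c
  | Imp b c => ~` val v b `|` val v c
  | Box b => coder (tau0 S) (val v b)
  | Rhd b c => erhd (tau0 S) (tau1 S) (val v b) (val v c)
  end.

Lemma val_Dia (S : bitop_space) (v : nat -> set S) (a : formula) :
  val v (Dia a) = der (tau0 S) (val v a).
Proof. by rewrite /= /coder !setCK. Qed.

Definition Log (S : bitop_space) : set formula :=
  [set a | forall v : nat -> set S, val v a = setT].

Definition top_valid (L : set formula) (a : formula) : Prop :=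
  forall S : bitop_space, L `<=` Log S -> Log S a.

Definition top_complete (L : set formula) : Prop :=
  forall a : formula, top_valid L a -> L a.

(* Main.v *)
(* Contrapositively: a formula outside L is refuted on a frame (X, R, S), read
   as the bitopological space whose topologies are the R-upsets and the
   S-upsets. There a |> b holds at x when every y in R[x] satisfying a has some
   z in R[x] with S y z satisfying b, so the extra axioms become conditions:
   J5: R is included in S;  M: S;R is included in R;  P: R y u and S u v imply
   R y v;  W: S;R has no infinite chains.
   The points of X are finite histories of maximal consistent sets. A Succ step
   adds a witness against b |> c at the current point, which must be
   c-critical: it contains no d with d |> c at that point. A Jump step returns
   to an earlier point p and adds what a |> b at p demands from an a-point,
   preserving criticality. S prolongs the history, so it never returns to a
   block of critical points that it has left; this is what makes a single S
   sufficient, instead of one relation for each point.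
   For R to be well-founded the witnesses are taken so that a point of type t
   (with respect to the subformulas of the refuted formula) contains the boxed
   negation of t; by Loeb's axiom this is always possible. *)
From HB Require Import structures.
From mathcomp Require Import all_boot.
From mathcomp Require Import boolp classical_sets topology_structure.
Require Import Defs.
Set Implicit Arguments.
Unset Strict Implicit.
Unset Printing Implicit Defensive.
Local Open Scope classical_set_scope.

(** * Alexandroff spaces of frames *)

Section UpsetTopology.
Variables (X : Type) (R : X -> X -> Prop).

Definition upset (U : set X) : Prop := forall x y, R x y -> U x -> U y.

(** Topological structures are built on choice types; [{classic X}] turns an arbitrary [X] into
    one. *)
Definition upset_carrier : Type := {classic X}.
HB.instance Definition _ := Choice.on upset_carrier.

Lemma upsetT : upset [set: X]. Proof. by []. Qed.

Lemma upsetI (A B : set X) : upset A -> upset B -> upset (A `&` B).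
Proof. by move=> oA oB x y xy [/(oA _ _ xy) Ay /(oB _ _ xy) By]. Qed.

Lemma upset_bigcup (I : Type) (f : I -> set X) :
  (forall i, upset (f i)) -> upset (\bigcup_i f i).
Proof. by move=> of_ x y xy [i _ fx]; exists i => //; apply: of_ fx. Qed.

HB.instance Definition _ :=
  isOpenTopological.Build upset_carrier upsetT upsetI upset_bigcup.

Definition upset_topology : Topological X := Topological.class upset_carrier.

End UpsetTopology.


(** * Soundness of rules and tautologies in every space *)

Section Validity.
Variable S : bitop_space.
Implicit Types (v : nat -> set S) (a b c : formula).

Lemma val_neg v a x : val v (Neg a) x <-> ~ val v a x.
Proof. by []. Qed.

Lemma val_and v a b x : val v (And a b) x <-> val v a x /\ val v b x.
Proof. by []. Qed.

Lemma val_or v a b x : val v (Or a b) x <-> val v a x \/ val v b x.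
Proof. by []. Qed.

Lemma val_imp v a b x : val v (Imp a b) x <-> (val v a x -> val v b x).
Proof.
by split=> [[]//|h]; have [/h|] := pselect (val v a x); [right | left].
Qed.

Lemma LogP a : Log S a <-> forall v x, val v a x.
Proof.
split=> [h v x|h v]; first by rewrite (h v).
by apply/seteqP; split.
Qed.

Lemma val_subst v s a : val v (subst s a) = val (fun n => val v (s n)) a.
Proof.
by elim: a => //=
  [b ->|b -> c ->|b -> c ->|b -> c ->|b ->|b -> c ->].
Qed.

Lemma Log_closed_rules : closed_rules (Log S).
Proof.
split.
- move=> a b /LogP ab /LogP a1; apply/LogP => v x.
  by have /val_imp := ab v x; apply.
- move=> a aS v; rewrite /= (aS v) /coder setCT derE.
  apply/seteqP; split=> // x _ /(_ setT (@openT (Topological.Pack _)) I).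
  by case=> y [_ []].
- by move=> s a /LogP h; apply/LogP => v x; rewrite val_subst; apply: h.
Qed.

Lemma Log_tautology a : tautology a -> Log S a.
Proof.
move=> ta; apply/LogP => v x.
(* The formulas true at [x] give an assignment to the propositional atoms. *)
suff <- : is_true (bool_eval (fun b => `[< val v b x >]) a) = val v a x.
  exact: ta.
apply/propext; elim: a {ta} => //=.
- by move=> n; split=> /asboolP.
- by move=> b IH; split=> [/negP h /IH//|h]; apply/negP => /IH.
- move=> b IHb c IHc; split=> [/andP[/IHb ? /IHc]//|[/IHb ? /IHc ?]].
  exact/andP.
- move=> b IHb c IHc; split=> [/orP[/IHb|/IHc]|[/IHb|/IHc]].
  + by left.
  + by right.
  + by move=> ->.
  + by move=> ->; rewrite orbT.
- move=> b IHb c IHc; split=> [/implyP h|/(@val_imp v) h].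
    by apply/(@val_imp v) => /IHb /h /IHc.
  by apply/implyP => /IHb /h /IHc.
- by move=> b _; split=> /asboolP.
- by move=> b _ c _; split=> /asboolP.
Qed.

Lemma Log_add_axiom (L : set formula) c : CL `<=` Log S ->
  L `<=` Log S -> Log S c -> add_axiom L c `<=` Log S.
Proof.
move=> CLS LS cS; apply: smallest_sub; last by move=> a [/LS|->].
by split=> //; exact: Log_closed_rules.
Qed.

End Validity.

(** * Spaces of transitive frames of bounded height and the frame conditions *)

Section Frame.
Variables (X : Type) (x0 : X) (R S : X -> X -> Prop) (rk : X -> nat) (N : nat).
Hypothesis R_trans : forall x y z, R x y -> R y z -> R x z.
Hypothesis R_rk : forall x y, R x y -> rk x < rk y.
Hypothesis rk_le : forall x, rk x <= N.
Hypothesis S_refl : forall x, S x x.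
Hypothesis S_trans : forall x y z, S x y -> S y z -> S x z.

Definition frame_space : bitop_space :=
  @BitopSpace X (ex_intro _ x0 I) (upset_topology R) (upset_topology S).

Implicit Types (v : nat -> set frame_space) (a b c : formula).

Lemma der_frame (Y : set X) x :
  der (upset_topology R) Y x <-> exists2 y, R x y & Y y.
Proof.
rewrite derE; split=> [/(_ [set y | y = x \/ R x y])|[y xy Yy] U oU Ux].
  case; first by move=> y z yz [<-|xy]; right=> //; apply: R_trans yz.
    by left.
  by move=> y [[yx|xy] [Yy yx']]; [case: yx' | exists y].
exists y; split; first exact: oU xy Ux.
by split=> // yx; have := R_rk xy; rewrite yx ltnn.
Qed.

Lemma val_box v a x : val v (Box a) x <-> forall y, R x y -> val v a y.
Proof.
have -> : val v (Box a) x = ~ der (upset_topology R) (~` val v a) x by [].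
rewrite der_frame; split=> [h y xy|h [y /h]//].
by apply: contrapT => ay; apply: h; exists y.
Qed.

(** Among the open sets in the definition of [erhd] it suffices to test [S y], the least one
    containing [y]. *)
Lemma val_rhd v a b x : val v (Rhd a b) x <->
  forall y, R x y -> val v a y -> exists z, [/\ S y z, R x z & val v b z].
Proof.
split=> [h y xy ay|h U oU /der_frame[y xy [ay Uy]]].
  have oU : upset S (S y) by move=> z t zt yz; apply: S_trans zt.
  have /der_frame[z xz [bz yz]] : der (upset_topology R) (val v b `&` S y) x.
    by apply: h; [exact: oU | apply/der_frame; exists y].
  by exists z.
have [z [yz xz bz]] := h y xy ay.
by apply/der_frame; exists z => //; split=> //; apply: oU yz Uy.
Qed.

Lemma val_dia v a x : val v (Dia a) x <-> exists2 y, R x y & val v a y.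
Proof. by rewrite val_Dia der_frame. Qed.

Lemma frame_CL : CL `<=` Log frame_space.
Proof.
apply: smallest_sub; first exact: Log_closed_rules.
move=> a [[[[[[/Log_tautology//|->]|->]|->]|->]|->]|->]; apply/LogP => v x.
- apply/val_imp => /val_box pq; apply/val_imp => /val_box p.
  apply/val_box => y xy.
  by have /val_imp := pq y xy; apply; apply: p.
- apply/val_imp => /val_box h; apply/val_box => y.
  (* Converse well-founded induction along [R], available because [rk] is bounded by [N]. *)
  have [n] := ubnP (N - rk y); elim: n y => // n IHn y lt_n xy.
  have /val_imp := h y xy; apply; apply/val_box => z yz.
  apply: IHn; last exact: R_trans yz.
  have := R_rk yz; have := rk_le z => zN yz_rk.
  rewrite -ltnS; apply: leq_trans lt_n; rewrite ltnS ltn_sub2l //.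
  exact: leq_trans zN.
- apply/val_imp => /val_box h; apply/val_rhd => y xy py; exists y; split=> //.
  by have /val_imp := h y xy; apply.
- apply/val_imp => /val_and[/val_rhd pq /val_rhd qr]; apply/val_rhd => y xy py.
  have [z [yz xz qz]] := pq y xy py; have [t [zt xt rt]] := qr z xz qz.
  by exists t; split=> //; apply: S_trans zt.
- apply/val_imp => /val_and[/val_rhd pr /val_rhd qr].
  by apply/val_rhd => y xy [py|qy]; [exact: pr | exact: qr].
- apply/val_imp => /val_rhd pq; apply/val_imp => /val_dia[y xy py].
  by apply/val_dia; have [z [_ xz qz]] := pq y xy py; exists z.
Qed.

Lemma frame_J5 : (forall x y, R x y -> S x y) -> Log frame_space axJ5.
Proof.
move=> RS; apply/LogP => v x; apply/val_rhd => y xy /val_dia[z yz pz].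
by exists z; split=> //; [apply: RS | apply: R_trans yz].
Qed.

Lemma frame_M : (forall x y z, S x y -> R y z -> R x z) -> Log frame_space axM.
Proof.
move=> SR; apply/LogP => v x; apply/val_imp => /val_rhd pq.
apply/val_rhd => y xy /val_and[py /val_box ry].
have [z [yz xz qz]] := pq y xy py; exists z; split=> //; split=> //.
by apply/val_box => t zt; apply: ry; apply: SR zt.
Qed.

Lemma frame_P : (forall x y z, R x y -> S y z -> R x z) -> Log frame_space axP.
Proof.
move=> RS; apply/LogP => v x; apply/val_imp => /val_rhd pq.
apply/val_box => y xy; apply/val_rhd => z yz pz.
have [t [zt xt qt]] := pq z (R_trans xy yz) pz.
by exists t; split=> //; apply: RS zt.
Qed.

(** The measure [m] bounds the length of chains of [S] followed by [R]. If the witness [z] still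
    sees a point [t] where the antecedent holds, the search restarts at [t], where [m] is larger. *)
Lemma frame_W (m : X -> nat) (n : nat) : (forall x y, R x y -> S x y) ->
  (forall x, m x <= n) ->
  (forall x y, S x y -> m x <= m y) -> (forall x y, R x y -> m x < m y) ->
  Log frame_space axW.
Proof.
move=> RS m_le Sm Rm; apply/LogP => v x; apply/val_imp => /val_rhd pq.
apply/val_rhd => y; have [k] := ubnP (n - m y).
elim: k y => // k IHk y lt_k xy py.
have [z [yz xz qz]] := pq y xy py.
have [np|] := pselect (val v (Box (Neg (Var 0))) z); first by exists z; split.
rewrite val_box => /existsNP[t /not_implyP[zt /contrapT pt]].
have xt := R_trans xz zt.
have ytm : m y < m t by apply: leq_ltn_trans (Sm _ _ yz) (Rm _ _ zt).
have [] := IHk t _ xt pt.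
  rewrite -ltnS; apply: leq_trans lt_k; rewrite ltnS ltn_sub2l //.
  exact: leq_trans ytm (m_le t).
move=> s [ts xs qs]; exists s; split=> //.
exact: S_trans (S_trans yz (RS _ _ zt)) ts.
Qed.

End Frame.

(* Each node carries a pair of sets as in [shadow] below. In [Jump y p c g h]
   the node y is the previous end of the history and p the earlier node whose
   demand is met; c is the formula for which the new node is critical. *)
Inductive node : Type :=
| Root of set formula & set formula
| Succ of node & formula & set formula & set formula
| Jump of node & node & formula & set formula & set formula.

Definition th0 z :=
  match z with Root g _ => g | Succ _ _ g _ => g | Jump _ _ _ g _ => g end.
Definition th1 z :=
  match z with Root _ h => h | Succ _ _ _ h => h | Jump _ _ _ _ h => h end.
(** The immediate [R]-predecessor: where a [Succ] step starts, or where a [Jump] step returns to. *)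
Definition level z :=
  match z with Root _ _ => None | Succ y _ _ _ => Some y
  | Jump _ p _ _ _ => Some p end.
Fixpoint len z : nat :=
  match z with Root _ _ => 0 | Succ y _ _ _ => (len y).+1
  | Jump y _ _ _ _ => (len y).+1 end.

(* For j = false the prolongation may use Jump steps only; this is the relation
   S in the absence of J5, where R should not be included in S. *)
Fixpoint prefix (j : bool) q z : Prop :=
  q = z \/ match z with
           | Root _ _ => False
           | Succ y _ _ _ => j /\ prefix j q y
           | Jump y _ _ _ _ => prefix j q y
           end.

(** * The prolongation order on histories *)

Section Prefix.
Implicit Types (q p y z : node) (j : bool).

Lemma prefix_refl j z : prefix j z z.
Proof. by case: z; left. Qed.

Lemma prefix_succ y c g h : prefix true y (Succ y c g h).
Proof. by right; split=> //; apply: prefix_refl. Qed.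

Lemma prefix_jump j y p c g h : prefix j y (Jump y p c g h).
Proof. by right; apply: prefix_refl. Qed.

Lemma prefix_trans j q p z : prefix j q p -> prefix j p z -> prefix j q z.
Proof.
move=> qp; elim: z => [g h|y IHy c g h|y IHy p' _ c g h] [pz|pz] //.
- by rewrite -pz.
- by rewrite -pz.
- by right; case: pz => jT /IHy.
- by rewrite -pz.
- by right; apply: IHy.
Qed.

Lemma prefix_weak j q z : prefix j q z -> prefix true q z.
Proof.
elim: z => [g h|y IHy c g h|y IHy p _ c g h] /= [->|qz] //; try by left.
  by right; split=> //; case: qz => _ /IHy.
by right; apply: IHy.
Qed.

Lemma prefix_len j q z : prefix j q z -> len q <= len z.
Proof.
elim: z => [g h|y IHy c g h|y IHy p _ c g h] /= [->|qz] //.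
  by case: qz => _ /IHy /leqW.
by apply: leqW; apply: IHy.
Qed.

Lemma prefix_len_eq j q z : prefix j q z -> len z <= len q -> q = z.
Proof.
case: z => [g h|y c g h|y p c g h] /= [->|qz] //.
  by case: qz => _ /prefix_len qy /leq_trans /(_ qy); rewrite ltnn.
by move/prefix_len: qz => qy /leq_trans /(_ qy); rewrite ltnn.
Qed.

(** Prefixes of one history are linearly ordered by length, and the steps from [p] to [q] are among
    those from [p] to [z]. *)
Lemma prefix_compare j q p z : prefix true q z -> prefix j p z ->
  len p <= len q -> prefix j p q.
Proof.
elim: z => [g h|y IHy c g h|y IHy p' _ c g h] [->|qz] pz //.
- case: pz => [->|[jT py]]; last by apply: IHy => //; case: qz.
  by case: qz => _ /prefix_len qy /= /leq_trans /(_ qy); rewrite ltnn.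
- case: pz => [->|py]; last exact: IHy.
  by move/prefix_len: qz => qy /= /leq_trans /(_ qy); rewrite ltnn.
Qed.

End Prefix.


(** * Maximal consistent sets *)

(** Decides tautology schemes by splitting on the value of every schematic letter and every modal
    atom. *)
Ltac eval_atoms :=
  repeat match goal with
  | |- context [bool_eval ?tt ?aa] => destruct (bool_eval tt aa)
  | |- context [?tt (Box ?aa)] => destruct (tt (Box aa))
  | |- context [?tt (Rhd ?aa ?bb)] => destruct (tt (Rhd aa bb))
  end.

HB.instance Definition _ := gen_eqMixin formula.

Fixpoint subformulas a : seq formula :=
  a :: match a with
       | Neg b | Box b => subformulas b
       | And b c | Or b c | Imp b c | Rhd b c => subformulas b ++ subformulas c
       | _ => [::]
       end.

Section Logic.
Variable L : set formula.
Hypothesis CL_sub : CL `<=` L.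
Hypothesis L_rules : closed_rules L.
Implicit Types (a b c d : formula) (G D F : set formula).

Lemma L_mp a b : L (Imp a b) -> L a -> L b.
Proof. by case: L_rules => mp _ _; apply: mp. Qed.

Lemma L_nec a : L a -> L (Box a).
Proof. by case: L_rules => _ nec _; apply: nec. Qed.

Lemma L_subst s a : L a -> L (subst s a).
Proof. by case: L_rules => _ _; apply. Qed.

Lemma L_taut a : tautology a -> L a.
Proof.
move=> ta; apply: CL_sub; apply: sub_gen_smallest.
by do 6 left.
Qed.

Let inst a b c := fun n => nth Top [:: a; b; c] n.

Ltac taut := apply: L_taut => ? /=; eval_atoms => //.

Lemma L_K a b : L (Imp (Box (Imp a b)) (Imp (Box a) (Box b))).
Proof.
apply: (@L_subst (inst a b Top) axK).
by apply: CL_sub; apply: sub_gen_smallest; do 5 left; right.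
Qed.

Lemma L_lob a : L (Imp (Box (Imp (Box a) a)) (Box a)).
Proof.
apply: (@L_subst (inst a Top Top) axL).
by apply: CL_sub; apply: sub_gen_smallest; do 4 left; right.
Qed.

Lemma L_J1 a b : L (Imp (Box (Imp a b)) (Rhd a b)).
Proof.
apply: (@L_subst (inst a b Top) axJ1).
by apply: CL_sub; apply: sub_gen_smallest; do 3 left; right.
Qed.

Lemma L_J2 a b c : L (Imp (And (Rhd a b) (Rhd b c)) (Rhd a c)).
Proof.
apply: (@L_subst (inst a b c) axJ2).
by apply: CL_sub; apply: sub_gen_smallest; do 2 left; right.
Qed.

Lemma L_J3 a b c : L (Imp (And (Rhd a c) (Rhd b c)) (Rhd (Or a b) c)).
Proof.
apply: (@L_subst (inst a b c) axJ3).
by apply: CL_sub; apply: sub_gen_smallest; left; right.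
Qed.

Lemma L_J4 a b : L (Imp (Rhd a b) (Imp (Dia a) (Dia b))).
Proof.
apply: (@L_subst (inst a b Top) axJ4).
by apply: CL_sub; apply: sub_gen_smallest; right.
Qed.

Lemma L_J5 a : L axJ5 -> L (Rhd (Dia a) a).
Proof. exact: (@L_subst (inst a Top Top)). Qed.

Lemma L_M a b c : L axM ->
  L (Imp (Rhd a b) (Rhd (And a (Box c)) (And b (Box c)))).
Proof. exact: (@L_subst (inst a b c)). Qed.

Lemma L_P a b : L axP -> L (Imp (Rhd a b) (Box (Rhd a b))).
Proof. exact: (@L_subst (inst a b Top)). Qed.

Lemma L_W a b : L axW -> L (Imp (Rhd a b) (Rhd a (And b (Box (Neg a))))).
Proof. exact: (@L_subst (inst a b Top)). Qed.

Lemma L_trans a b c : L (Imp a b) -> L (Imp b c) -> L (Imp a c).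
Proof.
by move=> ab bc; apply: L_mp _ bc; apply: L_mp _ ab; taut.
Qed.

Lemma L_box_mono a b : L (Imp a b) -> L (Imp (Box a) (Box b)).
Proof. by move=> /L_nec; apply: L_mp; apply: L_K. Qed.

Lemma L_rhd a b : L (Imp a b) -> L (Rhd a b).
Proof. by move=> /L_nec; apply: L_mp; apply: L_J1. Qed.

Lemma L_boxI a b : L (Imp (Box a) (Imp (Box b) (Box (And a b)))).
Proof.
by apply: L_trans (L_K b (And a b)); apply: L_box_mono; taut.
Qed.

(* Loeb's axiom is applied to [And a (Box a)]. *)
Lemma L_box4 a : L (Imp (Box a) (Box (Box a))).
Proof.
pose c := And a (Box a).
have h1 : L (Imp (Box c) (Box a)) by apply: L_box_mono; taut.
have h2 : L (Imp (Box c) (Box (Box a))) by apply: L_box_mono; taut.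
apply: L_trans h2; apply: L_trans (L_lob c); apply: L_box_mono.
by apply: L_mp _ h1; taut.
Qed.

Definition mcs G : Prop :=
  [/\ L `<=` G, forall a b, G (Imp a b) -> G a -> G b
    & forall a, G (Neg a) <-> ~ G a].

Definition is_filter F : Prop :=
  [/\ F Top, forall a b, L (Imp a b) -> F a -> F b
    & forall a b, F a -> F b -> F (And a b)].

(** The prime filter theorem: a filter containing [F] that is maximal among those avoiding [I]
    decides every formula. *)
Lemma mcs_separation (F I : set formula) : is_filter F ->
  I Bot -> (forall a b, I a -> I b -> I (Or a b)) ->
  (forall a, F a -> ~ I a) ->
  exists G, [/\ mcs G, F `<=` G & forall a, I a -> ~ G a].
Proof.
move=> [F1 Fup FI] I0 IU dFI.
(* Phrased for the union with [F], so that the empty union of the empty chain satisfies [P] too. *)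
pose P X := is_filter (F `|` X) /\ forall a, (F `|` X) a -> ~ I a.
have [|X [[[Y1 Yup YI] dYI] Xmax]] := @Zorn_bigcup formula P.
  move=> C CP Ctot.
  have up a : (F `|` \bigcup_(X in C) X) a ->
      F a \/ exists2 X, C X & (F `|` X) a.
    by case=> [|[X CX Xa]]; [left | right; exists X => //; right].
  split; last first.
    by move=> a [/dFI//|[X CX Xa]]; have [_] := CP X CX; apply; right.
  split; first by left.
  - move=> a b ab [/(Fup _ _ ab)|[X CX Xa]]; first by left.
    have [[_ Xup _] _] := CP X CX.
    by have [|Xb] := Xup a b ab (or_intror Xa); [left | right; exists X].
  - have key a b X : C X -> (F `|` X) a -> (F `|` X) b ->
        (F `|` \bigcup_(X in C) X) (And a b).
      move=> CX Xa Xb; have [[_ _ XI] _] := CP X CX.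
      by have [|Xab] := XI a b Xa Xb; [left | right; exists X].
    move=> a b [Fa|[X CX Xa]] [Fb|[Y CY Yb]].
    + by left; apply: FI.
    + by apply: (key _ _ Y) => //; [left | right].
    + by apply: (key _ _ X) => //; [right | left].
    + have [XY|YX] := Ctot X Y CX CY.
        by apply: (key _ _ Y) => //; right => //; apply: XY.
      by apply: (key _ _ X) => //; right => //; apply: YX.
pose Y := F `|` X.
(* If [c] is not in [Y], the filter [X'] generated by [Y] and [c] must meet [I]. Used below for a
   formula and its negation. *)
have Ydec c : Y c \/ exists g b, [/\ Y g, I b & L (Imp g (Imp c b))].
  apply: contrapT => /not_orP[Yc noc].
  pose X' := [set x | exists2 g, Y g & L (Imp g (Imp c x))].
  have XX' : Y `<=` X' by move=> x Yx; exists x => //; taut.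
  apply: (Xmax X').
    split=> [x Xx|X'X]; first by apply: XX'; right.
    by apply: Yc; right; apply: X'X; exists Top => //; taut.
  rewrite /P; have -> : F `|` X' = X'.
    by apply/seteqP; split=> x; [case=> // Fx; apply: XX'; left | right].
  split; last by move=> a [g Yg ga] Ia; apply: noc; exists g, a.
  split; first by apply: XX'.
  - move=> a b ab [g Yg ga]; exists g => //.
    by apply: L_mp _ ga; apply: L_mp _ ab; taut.
  - move=> a b [g Yg ga] [h Yh hb]; exists (And g h); first exact: YI.
    by apply: L_mp _ hb; apply: L_mp _ ga; taut.
exists Y; split; last by move=> a Ia /dYI.
- split.
  + by move=> a La; apply: Yup Y1; apply: L_mp _ La; taut.
  + move=> a b Yab Ya; apply: Yup (YI _ _ Yab Ya); taut.
  + move=> a; split=> [Yna Ya|].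
      by apply: (dYI Bot) => //; apply: Yup (YI _ _ Yna Ya); taut.
    have [//|[g [b [Yg Ib gab]]] _] := Ydec a.
    have [//|[h [d [Yh Id had]]]] := Ydec (Neg a).
    case: (dYI (Or b d)); last exact: IU.
    apply: Yup (YI _ _ Yg Yh).
    by apply: L_mp _ gab; apply: L_mp _ had; taut.
- by left.
Qed.

Section MCS.
Variable G : set formula.
Hypothesis G_mcs : mcs G.

Lemma mcs_L a : L a -> G a.
Proof. by case: G_mcs => h _ _; apply: h. Qed.

Lemma mcs_mp a b : G (Imp a b) -> G a -> G b.
Proof. by case: G_mcs => _ h _; apply: h. Qed.

Lemma mcs_neg a : G (Neg a) <-> ~ G a.
Proof. by case: G_mcs. Qed.

Lemma mcs_sub a b : L (Imp a b) -> G a -> G b.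
Proof. by move=> /mcs_L; apply: mcs_mp. Qed.

Lemma mcs_top : G Top.
Proof. by apply: mcs_L; taut. Qed.

Lemma mcs_bot : ~ G Bot.
Proof. by apply/mcs_neg; apply: mcs_L; taut. Qed.

Lemma mcs_and a b : G (And a b) <-> G a /\ G b.
Proof.
split=> [Gab|[Ga Gb]]; first by split; apply: mcs_sub Gab; taut.
by apply: mcs_mp Gb; apply: mcs_sub Ga; taut.
Qed.

Lemma mcs_imp a b : G (Imp a b) <-> (G a -> G b).
Proof.
split=> [|h]; first exact: mcs_mp.
have [/h|/mcs_neg] := pselect (G a); by apply: mcs_sub; taut.
Qed.

Lemma mcs_or a b : G (Or a b) <-> G a \/ G b.
Proof.
split=> [Gab|]; last by case; apply: mcs_sub; taut.
have [|/mcs_neg Gna] := pselect (G a); [by left | right].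
by apply: mcs_mp Gna; apply: mcs_sub Gab; taut.
Qed.

Lemma mcs_box4 a : G (Box a) -> G (Box (Box a)).
Proof. by apply: mcs_sub; apply: L_box4. Qed.

Lemma mcs_boxI a b : G (Box a) -> G (Box b) -> G (Box (And a b)).
Proof. by move=> Ga; apply: mcs_mp; apply: mcs_sub Ga; apply: L_boxI. Qed.

Lemma mcs_box_sub a b : L (Imp a b) -> G (Box a) -> G (Box b).
Proof. by move=> /L_box_mono; apply: mcs_sub. Qed.

Lemma mcs_rhd_box a b : G (Box (Imp a b)) -> G (Rhd a b).
Proof. by apply: mcs_sub; apply: L_J1. Qed.

Lemma mcs_rhd_L a b : L (Imp a b) -> G (Rhd a b).
Proof. by move=> /L_rhd /mcs_L. Qed.

Lemma mcs_rhd_trans a b c : G (Rhd a b) -> G (Rhd b c) -> G (Rhd a c).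
Proof.
by move=> ab bc; apply: mcs_sub (L_J2 a b c) _; apply/mcs_and.
Qed.

Lemma mcs_rhd_or a b c : G (Rhd a c) -> G (Rhd b c) -> G (Rhd (Or a b) c).
Proof.
by move=> ac bc; apply: mcs_sub (L_J3 a b c) _; apply/mcs_and.
Qed.

Lemma mcs_rhd_bot a : G (Rhd a Bot) -> G (Box (Neg a)).
Proof.
move=> /(mcs_sub (L_J4 a Bot)) h; apply: contrapT => /mcs_neg /(mcs_mp h).
by move=> /mcs_neg; apply; apply: mcs_L; apply: L_nec; taut.
Qed.

End MCS.


(** * Consequences of Loeb's axiom, and critical sets *)

Lemma L_dia_lob a : L (Imp (Dia a) (Dia (And a (Box (Neg a))))).
Proof.
have h := L_lob (Neg a).
have k : L (Imp (Box (Neg (And a (Box (Neg a)))))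
              (Box (Imp (Box (Neg a)) (Neg a)))).
  by apply: L_box_mono; taut.
by apply: L_mp _ (L_trans k h); rewrite /Dia; taut.
Qed.

(** Where [a] holds, either it holds for the last time or a last occurrence is seen above; J5
    removes the diamond in the second case. *)
Lemma L_rhd_lob a : L axJ5 -> L (Rhd a (And a (Box (Neg a)))).
Proof.
move=> j5; set b := And a (Box (Neg a)).
have h1 : L (Rhd a (Or b (Dia b))).
  apply: L_rhd; apply: L_mp _ (L_dia_lob a); rewrite -/b.
  by rewrite /b /Dia; taut.
have h2 : L (Rhd (Or b (Dia b)) b).
  apply: L_mp (L_J3 _ _ _) _.
  apply: L_mp _ (L_J5 b j5); apply: L_mp _ (@L_rhd b b _); last by taut.
  by taut.
apply: L_mp (L_J2 a (Or b (Dia b)) b) _.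
by apply: L_mp _ h1; apply: L_mp _ h2; taut.
Qed.

(* As [Box d] is equivalent to [Rhd (Neg d) Bot], this includes the usual
   accessibility relation between maximal consistent sets: see [crit_box]. *)
Definition crit G c D : Prop := forall b, G (Rhd b c) -> ~ D b.

Lemma crit_box G c D d : mcs G -> mcs D -> crit G c D ->
  G (Box d) -> D d /\ D (Box d).
Proof.
move=> Gm Dm GD; suff key e : G (Box e) -> D e.
  by move=> Gd; split; apply: key => //; apply: mcs_box4.
move=> Ge; apply: contrapT => /(mcs_neg Dm); apply: GD.
by apply: (mcs_rhd_box Gm); apply: mcs_box_sub Ge => //; taut.
Qed.

Lemma crit_weaken G c c' D : mcs G -> L (Imp c c') -> crit G c' D -> crit G c D.
Proof.
move=> Gm cc' GD b bc; apply: GD.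
by apply: mcs_rhd_trans bc _ => //; apply: mcs_rhd_L.
Qed.

Lemma crit_bot G c D : mcs G -> crit G c D -> crit G Bot D.
Proof. by move=> Gm; apply: crit_weaken => //; taut. Qed.

Lemma crit_botP G D : mcs G -> mcs D ->
  (forall d, G (Box d) -> D d) -> crit G Bot D.
Proof. by move=> Gm Dm GD b /(mcs_rhd_bot Gm) /GD /(mcs_neg Dm). Qed.

(** [Dia b] interprets [b], hence also [c], so a critical set omits [Dia b] as well. The resulting
    box carries criticality to all later successors. *)
Lemma crit_J5 G c D b : L axJ5 -> mcs G -> mcs D -> crit G c D ->
  G (Rhd b c) -> D (Box (Neg b)).
Proof.
move=> j5 Gm Dm GD bc; apply: contrapT => /(mcs_neg Dm); apply: GD.
by apply: mcs_rhd_trans bc => //; apply: mcs_L => //; apply: L_J5.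
Qed.

(** The requirement on a source of boxes to be inherited: a maximal consistent set, or [L] itself
    when nothing has to be inherited. *)
Definition box_closed (Y : set formula) : Prop :=
  Y (Box Top) /\ forall a b, Y (Box a) -> Y (Box b) -> Y (Box (And a b)).

Lemma mcs_box_closed G : mcs G -> box_closed G.
Proof.
move=> Gm; split; last by move=> a b; apply: mcs_boxI.
by apply: mcs_L => //; apply: L_nec; taut.
Qed.

Lemma L_box_closed : box_closed L.
Proof.
split=> [|a b La Lb]; first by apply: L_nec; taut.
by apply: L_mp Lb; apply: L_mp La; apply: L_boxI.
Qed.

(** Separates the filter generated by [a] and the boxes of [Y] from the formulas [b] with [Rhd b c]
    in [G]; J3 closes the latter under disjunction. *)
Lemma crit_exists G a c Y : mcs G -> box_closed Y ->
  (forall d, Y (Box d) -> ~ G (Rhd (And a (Box d)) c)) ->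
  exists D, [/\ mcs D, crit G c D, D a & forall d, Y (Box d) -> D (Box d)].
Proof.
move=> Gm [Y1 YI] GY.
pose F := [set x | exists2 d, Y (Box d) & L (Imp (And a (Box d)) x)].
have Ff : is_filter F.
  split.
  - by exists Top => //; taut.
  - by move=> x y xy [d Yd dx]; exists d => //; apply: L_trans xy.
  - move=> x y [d Yd dx] [e Ye ey]; exists (And d e); first exact: YI.
    have h1 : L (Imp (Box (And d e)) (Box d)) by apply: L_box_mono; taut.
    have h2 : L (Imp (Box (And d e)) (Box e)) by apply: L_box_mono; taut.
    apply: L_mp _ dx; apply: L_mp _ ey; apply: L_mp _ h1; apply: L_mp _ h2.
    by taut.
have [|x y||D [Dm FD ID]] := @mcs_separation F [set b | G (Rhd b c)] Ff.
- by apply: mcs_rhd_L => //; taut.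
- exact: mcs_rhd_or.
- move=> x [d Yd dx] xc; apply: (GY d Yd).
  by apply: mcs_rhd_trans xc => //; apply: mcs_rhd_L.
exists D; split=> //; first by apply: FD; exists Top => //; taut.
by move=> d Yd; apply: FD; exists d => //; taut.
Qed.

(** * Types over a finite set of formulas and their rank *)

Section Types.
Variable Phi : seq formula.

Fixpoint literals (e : seq bool) (s : seq formula) : formula :=
  match e, s with
  | i :: e', a :: s' => And (if i then a else Neg a) (literals e' s')
  | _, _ => Top
  end.

Definition bits D := [tuple of [seq `[< D a >] | a <- in_tuple Phi]].
Definition chi (e : (size Phi).-tuple bool) : formula := literals e Phi.

Lemma chiP D e : mcs D -> D (chi e) <-> bits D = e.
Proof.
move=> Dm; rewrite (rwP (@eqP _ (bits D) e)) -val_eqE /= /chi.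
have : size e = size Phi by rewrite size_tuple.
elim: Phi (tval e) => [|a s IHs] [|i e'] //=.
  by split=> // _; apply: mcs_top.
move=> [/IHs{}IHs]; rewrite mcs_and // IHs eqseq_cons.
split=> [[Di ->]|/andP[/eqP <- ->]]; last split=> //.
  rewrite andbT; case: i Di => [Da|/(mcs_neg Dm) Da].
    by rewrite asboolT.
  by rewrite asboolF.
by case: asboolP => // /(mcs_neg Dm).
Qed.

Lemma bits_mem D D' a : a \in Phi -> bits D = bits D' -> D a <-> D' a.
Proof.
move=> aPhi /(congr1 (@tval _ _)) /=.
move=> /(congr1 (fun s => nth false s (index a Phi))).
rewrite !(nth_map Bot) ?index_mem // !nth_index // => h.
by split=> /asboolP; [rewrite h | rewrite -h] => /asboolP.
Qed.

Definition good D : Prop := D (Box (Neg (chi (bits D)))).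

Definition excluded D : pred ((size Phi).-tuple bool) :=
  fun e => `[< D (Box (Neg (chi e))) >].
Definition rank D : nat := #|excluded D|.

Lemma rank_le D D' :
  (forall d, D (Box d) -> D' (Box d)) -> rank D <= rank D'.
Proof.
move=> DD'; apply: subset_leq_card; apply/fintype.subsetP => e.
by rewrite !unfold_in => /asboolP /DD' /asboolP.
Qed.

(** Excluded types stay excluded along boxes. The type of [D'] is new: [D'] excludes it, being good,
    while [D] does not, since [D0] above [D] has that type. *)
Lemma rank_lt D D0 D' c : mcs D -> mcs D0 -> crit D c D0 ->
  bits D0 = bits D' -> good D' -> (forall d, D0 (Box d) -> D' (Box d)) ->
  rank D < rank D'.
Proof.
move=> Dm D0m DD0 D0D' gD' bD'.
apply: proper_card; apply/fintype.properP; split.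
  apply/fintype.subsetP => e; rewrite !unfold_in => /asboolP De; apply/asboolP.
  by apply: bD'; have [] := crit_box Dm D0m DD0 De.
exists (bits D'); rewrite unfold_in; first exact/asboolP.
apply/asboolP => /(crit_box Dm D0m DD0)[/(mcs_neg D0m)+ _].
by rewrite chiP.
Qed.

Lemma rank_bound D : rank D <= 2 ^ size Phi.
Proof. by rewrite -card_bool -card_tuple max_card. Qed.

(** * Existence of critical sets with good shadows *)

Section Shadow.
Variables j5 m : bool.
Hypothesis J5_L : j5 -> L axJ5.
Hypothesis M_L : m -> L axM.

(* Without J5 a critical set D need not have a good critical set of the same
   type; a point then carries both D, used when it is seen from below, and a
   good D' of the same type, used for its own successors. *)
Definition shadow D D' : Prop :=
  [/\ mcs D, mcs D', bits D = bits D' & good D'] /\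
  (forall d, D d -> D (Box d) -> D' d /\ D' (Box d)) /\ (j5 -> D = D').

Lemma shadow_box D D' d : shadow D D' -> D (Box d) -> D' (Box d).
Proof.
move=> [[Dm _ _ _] [DD' _]] Dd.
by have [] := DD' _ Dd (mcs_box4 Dm Dd).
Qed.

Lemma shadow_mem D D' a : shadow D D' -> a \in Phi -> D a <-> D' a.
Proof. by move=> [[_ _ DD' _] _] aPhi; apply: bits_mem. Qed.

Lemma shadow_crit G c D D' : mcs G -> shadow D D' ->
  crit G c D -> crit G Bot D'.
Proof.
move=> Gm [[Dm D'm _ _] [DD' _]] GD; apply: crit_botP => // d Gd.
have [Dd Dbd] := crit_box Gm Dm GD Gd.
by have [] := DD' d Dd Dbd.
Qed.

(** If [D] is not good, it sees its own type, and by Loeb's axiom a last occurrence of it. Both [d]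
    and [Box d] are assumed because [D'] may be [D] itself. *)
Lemma good_exists D : mcs D -> exists D', [/\ mcs D', bits D = bits D', good D'
  & forall d, D d -> D (Box d) -> D' d /\ D' (Box d)].
Proof.
move=> Dm; have [gD|ngD] := pselect (good D).
  by exists D; split=> // d Dd Dbd; split.
set t := chi (bits D).
have [d Ld h|D' [D'm DD' D't _]] :=
  @crit_exists D (And t (Box (Neg t))) Bot L Dm L_box_closed.
  case: ngD.
  apply: contrapT => ngD; have : D (Dia t) by apply/mcs_neg.
  move=> /(mcs_sub Dm (L_dia_lob t)) /(mcs_neg Dm); case.
  apply: mcs_box_sub (mcs_rhd_bot Dm h) => //.
  by apply: L_mp _ Ld; taut.
have [D't1 D't2] : D' t /\ D' (Box (Neg t)) by apply/mcs_and.
have bb : bits D = bits D' by apply/esym/chiP.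
exists D'; split=> //; first by rewrite /good -bb.
by move=> d _; apply: crit_box DD'.
Qed.

(** With J5 the last occurrence of the type of [E] can be taken critical again; without J5 only the
    shadow is good. As [a] may lie outside [Phi], only [E] is claimed to contain it. *)
Lemma shadow_exists G a c Y : mcs G -> box_closed Y ->
  (forall d, Y (Box d) -> ~ G (Rhd (And a (Box d)) c)) ->
  exists E D D', [/\ shadow D D', crit G c D,
    forall d, Y (Box d) -> D (Box d), mcs E /\ E a & bits E = bits D'].
Proof.
move=> Gm Ycl GY; have [E [Em GE Ea YE]] := crit_exists Gm Ycl GY.
have [j|nj] := boolP j5; last first.
  have [D' [D'm ED' gD' bD']] := good_exists Em.
  by exists E, E, D'; split=> //; do 2 split=> //; move=> j; rewrite j in nj.
set t := chi (bits E).
have Et : E t by apply/chiP.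
have [d Ed h|D [Dm GD Dt ED]] :=
  @crit_exists G (And t (Box (Neg t))) c E Gm (mcs_box_closed Em).
  have Eb : E (And t (Box d)) by apply/mcs_and.
  apply: GE Eb; set b := And t (Box d).
  (* At a last occurrence of [b] the box of [d] is itself boxed, so it is a last occurrence of [t]
     too. *)
  apply: mcs_rhd_trans (mcs_L Gm (L_rhd_lob b (J5_L j))) _ => //.
  apply: mcs_rhd_trans h => //; apply: mcs_rhd_L => //.
  have k : L (Imp (Box (Box d)) (Imp (Box (Neg b)) (Box (Neg t)))).
    by apply: L_trans (L_K _ _); apply: L_box_mono; taut.
  by apply: L_mp _ k; apply: L_mp _ (L_box4 d); rewrite /b; taut.
have [Dt1 Dt2] : D t /\ D (Box (Neg t)) by apply/mcs_and.
have bb : bits E = bits D by apply/esym/chiP.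
exists E, D, D; split=> //; last by move=> d /YE /ED.
by split; [split=> //; rewrite /good -bb | split].
Qed.

Lemma shadow_rhd_false G a c : mcs G -> a \in Phi -> ~ G (Rhd a c) ->
  exists D D', [/\ shadow D D', crit G c D & D' a].
Proof.
move=> Gm aPhi Gac.
have [d Ld h|E [D [D' [DD' GD _ [_ Ea] ED']]]] :=
  @shadow_exists G a c L Gm L_box_closed.
  apply: Gac; apply: mcs_rhd_trans h => //; apply: mcs_rhd_L => //.
  by apply: L_mp _ Ld; taut.
by exists D, D'; split=> //; apply/(bits_mem aPhi ED').
Qed.

Lemma shadow_box_false G a : mcs G -> a \in Phi -> ~ G (Box a) ->
  exists D D', [/\ shadow D D', crit G Bot D & ~ D' a].
Proof.
move=> Gm aPhi Ga.
have [d Ld h|E [D [D' [DD' GD _ [Em Ea] ED']]]] :=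
  @shadow_exists G (Neg a) Bot L Gm L_box_closed.
  apply: Ga; apply: mcs_box_sub (mcs_rhd_bot Gm h) => //.
  by apply: L_mp _ Ld; taut.
by exists D, D'; split=> // /(bits_mem aPhi ED'); apply/mcs_neg.
Qed.

(** If [b] interpreted [c], so would [a], which is in the critical set [Y]. Under M the same
    argument runs with a box of [Y] conjoined to both. *)
Lemma shadow_rhd_true G c Y a b : mcs G -> mcs Y -> b \in Phi ->
  crit G c Y -> Y a -> G (Rhd a b) ->
  exists D D', [/\ shadow D D', crit G c D, D' b
    & m -> forall d, Y (Box d) -> D (Box d)].
Proof.
move=> Gm Ym bPhi GY Ya ab.
have [mT|mF] := boolP m; last first.
  have [|D [D' [DD' GD D'b]]] := @shadow_rhd_false G b c Gm bPhi.
    by move=> bc; apply: GY Ya; apply: mcs_rhd_trans bc.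
  by exists D, D'; split=> // mT; rewrite mT in mF.
have [d Yd h|E [D [D' [DD' GD YD [_ Eb] ED']]]] :=
  @shadow_exists G b c Y Gm (mcs_box_closed Ym).
  have Yad : Y (And a (Box d)) by apply/mcs_and.
  apply: GY Yad; apply: mcs_rhd_trans h => //.
  by apply: mcs_sub ab => //; apply: L_M; apply: M_L.
by exists D, D'; split=> //; apply/(bits_mem bPhi ED').
Qed.

(** Suppose [b] interprets [Or c (Dia a)]. Then so does [a], and W adds [Box (Neg a)] on the right,
    which leaves only [c]. *)
Lemma shadow_rhd_W G c Y a b : L axW -> mcs G -> b \in Phi ->
  crit G c Y -> Y a -> G (Rhd a b) ->
  exists D D', [/\ shadow D D', crit G (Or c (Dia a)) D & D' b].
Proof.
move=> W Gm bPhi GY Ya ab; apply: shadow_rhd_false => // bc.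
apply: GY Ya; apply: mcs_rhd_trans (mcs_sub Gm (L_W _ _ W) _) _ => //.
  by apply: mcs_rhd_trans ab bc.
by apply: mcs_rhd_L => //; rewrite /Dia; taut.
Qed.

Lemma root_exists a : a \in Phi -> ~ L a -> exists D D', shadow D D' /\ ~ D' a.
Proof.
move=> aPhi La.
have [||||G [Gm _ Ga]] := @mcs_separation L [set b | L (Imp b a)].
- split=> [|b c|b c Lb Lc]; [by taut | exact: L_mp |].
  by apply: L_mp _ Lc; apply: L_mp _ Lb; taut.
- by taut.
- by move=> b c ba ca; apply: L_mp _ ca; apply: L_mp _ ba; taut.
- by move=> b Lb ba; apply: La; apply: L_mp ba Lb.
have [D [Dm GD Dg _]] := good_exists Gm.
exists D, D; split; first by split; split.
by move=> /(bits_mem aPhi GD); apply: Ga; taut.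
Qed.


(** * The truth lemma, abstracted from the two constructions of frames *)

Section Truth.
Variables (X : Type) (x0 : X) (R S : X -> X -> Prop) (rk : X -> nat).
Hypothesis R_trans : forall x y z, R x y -> R y z -> R x z.
Hypothesis R_rk : forall x y, R x y -> rk x < rk y.
Hypothesis S_refl : forall x, S x x.
Hypothesis S_trans : forall x y z, S x y -> S y z -> S x z.
Variable th : X -> set formula.
Hypothesis th_mcs : forall x, mcs (th x).
Hypothesis box_true : forall x y a, a \in Phi -> Box a \in Phi ->
  th x (Box a) -> R x y -> th y a.
Hypothesis box_false : forall x a, a \in Phi ->
  ~ th x (Box a) -> exists2 y, R x y & ~ th y a.
Hypothesis rhd_true : forall x y a b, a \in Phi -> b \in Phi ->
  Rhd a b \in Phi -> th x (Rhd a b) -> R x y -> th y a ->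
  exists z, [/\ S y z, R x z & th z b].
Hypothesis rhd_false : forall x a b, a \in Phi -> b \in Phi ->
  ~ th x (Rhd a b) ->
  exists y, [/\ R x y, th y a & forall z, S y z -> R x z -> ~ th z b].

Lemma truth (a : formula) : {subset subformulas a <= Phi} ->
  forall x : X,
  @val (frame_space x0 R S) (fun n x => th x (Var n)) a x <-> th x a.
Proof.
have sub (b : formula) (c : seq formula) : {subset b :: c <= Phi} ->
    b \in Phi /\ {subset c <= Phi}.
  by move=> h; split=> [|d dc]; apply: h; rewrite !inE ?eqxx // dc orbT.
have sub2 (b c : seq formula) : {subset b ++ c <= Phi} ->
    {subset b <= Phi} /\ {subset c <= Phi}.
  by move=> h; split=> d dc; apply: h; rewrite mem_cat dc ?orbT.
have self b : {subset subformulas b <= Phi} -> b \in Phi.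
  by apply; case: b => *; rewrite inE eqxx.
elim: a => [n|||b IHb|b IHb c IHc|b IHb c IHc|b IHb c IHc|b IHb|b IHb c IHc]
  h x.
- by [].
- by split=> // _; apply: mcs_top.
- by split=> // /(mcs_bot (th_mcs x)).
- have [_ /IHb{}IHb] := sub _ _ h.
  by rewrite mcs_neg // val_neg IHb.
- have [_ /sub2[/IHb{}IHb /IHc{}IHc]] := sub _ _ h.
  by rewrite mcs_and // val_and IHb IHc.
- have [_ /sub2[/IHb{}IHb /IHc{}IHc]] := sub _ _ h.
  by rewrite mcs_or // val_or IHb IHc.
- have [_ /sub2[/IHb{}IHb /IHc{}IHc]] := sub _ _ h.
  by rewrite mcs_imp // val_imp IHb IHc.
- have [bbP hb] := sub _ _ h; have bP := self _ hb.
  rewrite (val_box R_trans R_rk); split=> [bx|bx y xy].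
    apply: contrapT => /(box_false bP)[y xy]; apply.
    by apply/IHb => //; apply: bx.
  by apply/IHb => //; apply: (box_true bP bbP bx xy).
- have [bcP /sub2[hb hc]] := sub _ _ h.
  have [bP cP] := (self _ hb, self _ hc).
  rewrite (val_rhd R_trans R_rk S_refl S_trans).
  split=> [bx|bx y xy /(IHb hb) yb].
    apply: contrapT => /(rhd_false bP cP)[y [xy /(IHb hb) yb noz]].
    have [z [yz xz /(IHc hc)]] := bx y xy yb; exact: noz.
  have [z [yz xz zc]] := rhd_true bP cP bcP bx xy yb.
  by exists z; split=> //; apply/IHc.
Qed.

End Truth.

(** * Counterexamples validating M *)

Definition boxes_le D E : Prop := forall d, D (Box d) -> E (Box d).

Lemma boxes_le_trans D E F : boxes_le D E -> boxes_le E F -> boxes_le D F.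
Proof. by move=> DE EF d /DE /EF. Qed.

Lemma shadow_boxes D D' : shadow D D' -> boxes_le D D'.
Proof. by move=> DD' d; apply: shadow_box. Qed.

Lemma crit_boxes G c D : mcs G -> mcs D -> crit G c D -> boxes_le G D.
Proof. by move=> Gm Dm GD d /(crit_box Gm Dm GD)[]. Qed.

Section MFrame.

(* A jump within the block opened by a Succ step at p keeps the criticality of
   that block and inherits boxes only from [th0 y]; any other jump inherits
   those of the good set [th1 y], hence its excluded types. *)
Fixpoint mvalid z : Prop :=
  match z with
  | Root g h => shadow g h
  | Succ y c g h => [/\ mvalid y, shadow g h & crit (th1 y) c g]
  | Jump y p c g h =>
      [/\ mvalid y, mvalid p, exists2 p', level y = Some p' & prefix true p p',
          [/\ shadow g h, crit (th0 p) Bot g & boxes_le (th0 y) g]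
        & (exists2 u, prefix j5 u y & exists g' h', u = Succ p c g' h') /\
            crit (th1 p) c g \/
          (forall u c' g' h', prefix j5 u y -> u <> Succ p c' g' h') /\
            boxes_le (th1 y) g]
  end.

(* M forces every prefix of a predecessor to be a predecessor. *)
Definition mrel q z : Prop := exists2 p, level z = Some p & prefix true q p.

Lemma mvalid_shadow z : mvalid z -> shadow (th0 z) (th1 z).
Proof. by case: z => [g h|y c g h|y p c g h] //= [] // _ _ _ []. Qed.

Lemma mvalid_mcs0 z : mvalid z -> mcs (th0 z).
Proof. by move=> /mvalid_shadow[[]]. Qed.

Lemma mvalid_mcs1 z : mvalid z -> mcs (th1 z).
Proof. by move=> /mvalid_shadow[[]]. Qed.

Lemma mvalid_boxes z : mvalid z -> boxes_le (th0 z) (th1 z).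
Proof. by move=> /mvalid_shadow /shadow_boxes. Qed.

Lemma mvalid_prefix q z : mvalid z -> prefix true q z -> mvalid q.
Proof.
elim: z => [g h|y IHy c g h|y IHy p _ c g h] zv [->|qz] //.
  by case: zv qz => /IHy h1 _ _ [_ /h1].
by case: zv qz => /IHy h1 _ _ _ _ /h1.
Qed.

Lemma level_prefix z p : mvalid z -> level z = Some p -> prefix true p z.
Proof.
elim: z p => [g h|y IHy c g h|y IHy p' _ c g h] p //.
  by move=> _ [<-]; apply: prefix_succ.
move=> [yv _ [p'' yp'' p'p''] _ _] [<-].
apply: prefix_trans (prefix_jump _ _ _ _ _ _).
exact: prefix_trans p'p'' (IHy _ yv yp'').
Qed.

Lemma mrel_prefix q z : mvalid z -> mrel q z -> prefix true q z.
Proof. by move=> zv [p /(level_prefix zv) pz qp]; apply: prefix_trans pz. Qed.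

Lemma mrel_trans q p z : mvalid p -> mrel q p -> mrel p z -> mrel q z.
Proof.
move=> pv /(mrel_prefix pv) qp [p' zp' pp'].
by exists p' => //; apply: prefix_trans pp'.
Qed.

Lemma prefix_boxes q z : mvalid z -> prefix true q z ->
  boxes_le (th0 q) (th0 z).
Proof.
elim: z => [g h|y IHy c g h|y IHy p _ c g h] zv [->|qz] //.
  case: zv qz => yv gh yg [_ /(IHy yv) qy]; apply: boxes_le_trans qy _.
  apply: boxes_le_trans (mvalid_boxes yv) _.
  by apply: crit_boxes yg; [exact: mvalid_mcs1 | case: gh => -[]].
by case: zv qz => yv _ _ [_ _ yg] _ /(IHy yv) qy; apply: boxes_le_trans yg.
Qed.

Lemma crit_bot_boxes G G' D : mcs G -> mcs G' -> mcs D ->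
  boxes_le G G' -> crit G' Bot D -> crit G Bot D.
Proof.
move=> Gm G'm Dm GG' G'D; apply: crit_botP => // d /GG' G'd.
by have [] := crit_box G'm Dm G'D G'd.
Qed.

(** Stated for [th0 q] because a jump guarantees only a set above [th0 p]; on [Phi] it agrees with
    [th1 p]. *)
Lemma mrel_crit q z : mvalid z -> mrel q z -> crit (th0 q) Bot (th0 z).
Proof.
move=> zv qz; have qv := mvalid_prefix zv (mrel_prefix zv qz).
have zm := mvalid_mcs0 zv; have qm := mvalid_mcs0 qv.
case: z zv zm qz => [g h|y c g h|y p c g h] zv zm [p' // [<-]].
  case: zv => yv _ yg qy; have ym := mvalid_mcs1 yv.
  apply: crit_bot_boxes (crit_bot ym yg) => //.
  by apply: boxes_le_trans (prefix_boxes yv qy) _; apply: mvalid_boxes.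
case: zv => _ pv _ [_ pg _] _ qp.
by apply: crit_bot_boxes pg => //; [exact: mvalid_mcs0 | exact: prefix_boxes].
Qed.

(** The height function of this frame; [rank] would not do directly, since a jump within a block may
    lose excluded types. *)
Fixpoint succs z : nat :=
  match z with
  | Root _ _ => 0
  | Succ y _ _ _ => (succs y).+1
  | Jump y _ _ _ _ => succs y
  end.

Lemma prefix_succs q z : prefix true q z -> succs q <= succs z.
Proof.
elim: z => [g h|y IHy c g h|y IHy p _ c g h] [->|qz] //.
  by case: qz => _ /IHy /= /leqW.
exact: IHy.
Qed.

Lemma mrel_succs q z : mvalid z -> mrel q z -> succs q < succs z.
Proof.
elim: z => [g h|y IHy c g h|y IHy p _ c g h] zv [p' // [<-]] qp.
  by rewrite ltnS prefix_succs.
case: zv => yv _ [p'' yp'' pp''] _ _; apply: IHy => //.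
by exists p'' => //; apply: prefix_trans pp''.
Qed.

Lemma block_succs q c g h y :
  prefix false (Succ q c g h) y -> succs y = (succs q).+1.
Proof.
elim: y => [g' h'|y IHy c' g' h'|y IHy p _ c' g' h'] [<-|qy] //.
  by case: qy.
exact: IHy.
Qed.

(* A node of a critical block at p may lose the types excluded at its
   predecessor, but it keeps those excluded at p, and the block accounts for
   just one Succ step. *)
Lemma succs_rank z : mvalid z -> succs z <= rank (th1 z).
Proof.
elim: z => [g h|y IHy c g h|y IHy p IHp c g h] //.
  move=> [yv gh yg]; apply: leq_ltn_trans (IHy yv) _.
  case: (gh) => -[gm hm bb gd] _.
  exact: rank_lt (mvalid_mcs1 yv) gm yg bb gd (shadow_boxes gh).
move=> [yv pv _ [gh _ yg]]; case: (gh) => -[gm hm bb gd] _.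
case=> [|[_ yg']]; last first.
  apply: leq_trans (IHy yv) _; apply: rank_le.
  exact: boxes_le_trans yg' (shadow_boxes gh).
move=> [[u uy [g' [h' uE]]] pg].
have [j|nj] := boolP j5.
  have [_ [_ /(_ j) yE]] := mvalid_shadow yv.
  apply: leq_trans (IHy yv) _; apply: rank_le; rewrite -yE.
  exact: boxes_le_trans yg (shadow_boxes gh).
move: uy; rewrite uE (negbTE nj) => /block_succs /= ->.
apply: leq_ltn_trans (IHp pv) _.
exact: rank_lt (mvalid_mcs1 pv) gm pg bb gd (shadow_boxes gh).
Qed.

(** In a block made of jumps alone, the place of return can only move down from [q]. *)
Lemma block_level q c g h y p : mvalid y ->
  prefix false (Succ q c g h) y -> level y = Some p -> prefix true p q.
Proof.
elim: y p => [g' h'|y IHy c' g' h'|y IHy p' _ c' g' h'] p // yv [uy|uy].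
- by move: uy => [<- _ _ _] [<-]; apply: prefix_refl.
- by case: uy.
- by [].
- case: yv => yv _ [p'' yp'' p'p''] _ _ [<-].
  exact: prefix_trans p'p'' (IHy _ yv uy yp'').
Qed.

Lemma prefix_anti p q : prefix true p q -> prefix true q p -> p = q.
Proof. by move=> pq /prefix_len; apply: prefix_len_eq pq. Qed.

(** A jump back to [q] keeps [c] by [mvalid]. For the other steps J5 provides boxes that persist
    along the history; without J5 no other step keeps [z] above [q]. *)
Lemma block_crit q c g h z : mvalid z ->
  prefix j5 (Succ q c g h) z -> mrel q z -> crit (th1 q) c (th0 z).
Proof.
set u := Succ q c g h => zv uz qz.
have uv := mvalid_prefix zv (prefix_weak uz).
have [qv gh qg] := uv.
have qm := mvalid_mcs1 qv; have um := mvalid_mcs0 uv.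
have zm := mvalid_mcs0 zv.
elim: z zv uz qz zm => [g' h'|y IHy c' g' h'|y IHy p IHp c' g' h'] zv.
- by case.
- move=> [<-//|[j uy]] qz zm b /(crit_J5 (J5_L j) qm um qg) ub zb.
  case: zv => yv _ yz; have ym := mvalid_mcs1 yv.
  have yb : th1 y (Box (Neg b)).
    apply: (mvalid_boxes yv); apply: prefix_boxes ub => //.
    exact: prefix_weak uy.
  by have [/(mcs_neg zm)] := crit_box ym zm yz yb.
move=> [//|uy] [_ [<-] qp] zm.
case: (zv) => yv pv [p' yp' pp'] [g'h' pg' yg'].
have [qEp|qp'] := pselect (q = p).
  move=> [[[v vy [g2 [h2 vE]]] pg2]|[nou _]]; last first.
    by rewrite -qEp in nou; case: (nou _ _ _ _ uy erefl).
  (* The block found by the jump is the given one, since prefixes of equal length coincide; hence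
     the two formulas agree. *)
  have vu : v = u.
    have lvu : len v = len u by rewrite vE /u qEp.
    have : prefix j5 v u.
      by apply: prefix_compare (prefix_weak uy) vy _; rewrite lvu.
    by move=> /prefix_len_eq; apply; rewrite lvu.
  by move: vu; rewrite vE /u qEp => -[<- _ _].
move=> _.
have lqp : len q < len p.
  by rewrite ltnNge; apply/negP => /(prefix_len_eq qp).
(* Without J5, [p] would be a prefix of [q], hence equal to it. With J5, [u] is a prefix of [p], so
   its boxes reach [z] through [p]. *)
have [j|nj] := boolP j5; last first.
  rewrite (negbTE nj) in uy.
  case: qp'; apply: prefix_anti qp _.
  exact: prefix_trans pp' (block_level yv uy yp').
move=> b /(crit_J5 (J5_L j) qm um qg) ub zb.
have py : prefix true p y by apply: prefix_trans pp' (level_prefix yv yp').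
have up : prefix true u p by apply: prefix_compare py (prefix_weak uy) _.
have pb : th0 p (Box (Neg b)) by apply: prefix_boxes ub.
by have [/(mcs_neg zm)] := crit_box (mvalid_mcs0 pv) zm pg' pb.
Qed.

(** * The frame of histories for logics with M *)

Section Counterexample.
Hypothesis m_true : m.
Variables (g0 h0 : set formula).
Hypothesis root_shadow : shadow g0 h0.

Let X := {z | mvalid z}.
Let x0 : X := exist mvalid (Root g0 h0) root_shadow.
Let R (x y : X) := mrel (sval x) (sval y).
Let S (x y : X) := prefix j5 (sval x) (sval y).
Let th (x : X) := th1 (sval x).

Lemma mframe_trans x y z : R x y -> R y z -> R x z.
Proof. exact: mrel_trans (svalP y). Qed.

Lemma mframe_succs x y : R x y -> succs (sval x) < succs (sval y).
Proof. exact: mrel_succs (svalP y). Qed.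

Lemma mframe_refl x : S x x. Proof. exact: prefix_refl. Qed.

Lemma mframe_Strans x y z : S x y -> S y z -> S x z.
Proof. exact: prefix_trans. Qed.

Lemma mframe_J5 x y : j5 -> R x y -> S x y.
Proof. by move=> j /(mrel_prefix (svalP y)); rewrite /S j. Qed.

Lemma mframe_M x y z : S x y -> R y z -> R x z.
Proof.
move=> /prefix_weak xy [p zp yp]; exists p => //.
exact: prefix_trans xy yp.
Qed.

Lemma mframe_mem0 x a : a \in Phi -> th x a <-> th0 (sval x) a.
Proof.
move=> aPhi; apply: iff_sym.
exact: shadow_mem (mvalid_shadow (svalP x)) aPhi.
Qed.

Lemma mframe_succ x c g h a : shadow g h -> crit (th x) c g ->
  exists y : X, [/\ R x y, sval y = Succ (sval x) c g h & th y a = h a].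
Proof.
move=> gh xg; have yv : mvalid (Succ (sval x) c g h).
  by split=> //; apply: svalP.
exists (exist _ _ yv); split=> //.
by exists (sval x) => //; apply: prefix_refl.
Qed.

Lemma mframe_truth (a : formula) : {subset subformulas a <= Phi} ->
  forall x : X,
  @val (frame_space x0 R S) (fun n x => th x (Var n)) a x <-> th x a.
Proof.
move: a; apply: (@truth X x0 R S (fun x => succs (sval x)) mframe_trans
  mframe_succs mframe_refl mframe_Strans th).
- by move=> x; apply: mvalid_mcs1 (svalP x).
- move=> x y a aP bP /(mframe_mem0 _ bP) xa xy; apply/mframe_mem0 => //.
  have xm := mvalid_mcs0 (svalP x); have ym := mvalid_mcs0 (svalP y).
  by have [] := crit_box xm ym (mrel_crit (svalP y) xy) xa.
- move=> x a aP xa; have xm := mvalid_mcs1 (svalP x).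
  have [D [D' [DD' xD D'a]]] := shadow_box_false xm aP xa.
  have [y [xy _ ya]] := mframe_succ a DD' xD.
  by exists y => //; rewrite ya.
- move=> x y a b aP bP abP xab xy ya.
  have [xv yv] := (svalP x, svalP y).
  have [xm xm'] := (mvalid_mcs0 xv, mvalid_mcs1 xv).
  have [ym ym'] := (mvalid_mcs0 yv, mvalid_mcs1 yv).
  have xy' := mrel_crit yv xy.
  have jump D D' : shadow D D' -> crit (th0 (sval x)) Bot D ->
      boxes_le (th0 (sval y)) D -> D' b ->
      (exists c, (exists2 u, prefix j5 u (sval y) &
        exists g' h', u = Succ (sval x) c g' h') /\ crit (th x) c D) \/
      (forall u c' g' h',
        prefix j5 u (sval y) -> u <> Succ (sval x) c' g' h') /\
        boxes_le (th y) D ->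
      exists z, [/\ S y z, R x z & th z b].
    move=> DD' xD yD D'b h.
    have [c zv] : exists c, mvalid (Jump (sval y) (sval x) c D D').
      (* Outside a block the formula in the jump is unconstrained, and [Bot] is an arbitrary
         choice. *)
      case: h => [[c h]|h]; [exists c | exists Bot]; split=> //; last by right.
      by left.
    exists (exist _ _ zv); split=> //; first exact: prefix_jump.
    by exists (sval x) => //; apply: prefix_refl.
  (* Inside a block opened at [x] the witness must remain [c]-critical. Outside it is built over
     [th0] of [x] instead, and can inherit all boxes of [th y]. *)
  have [[c [u uy [g [h uE]]]]|nou] := pselect (exists c, exists2 u,
      prefix j5 u (sval y) & exists g h, u = Succ (sval x) c g h).
    have xyc : crit (th x) c (th0 (sval y)).
      by apply: (@block_crit _ _ g h) => //; rewrite -uE.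
    have [D [D' [DD' xD D'b yD]]] :=
      shadow_rhd_true xm' ym bP xyc (proj1 (mframe_mem0 _ aP) ya) xab.
    apply: (jump D D') => //; last first.
    + by left; exists c; split=> //; exists u => //; exists g, h.
    + exact: yD.
    + have Dm : mcs D by case: DD' => -[].
      exact: crit_bot_boxes (mvalid_boxes xv) (crit_bot xm' xD).
  have [y0 yy] := mvalid_shadow yv.
  have xyc : crit (th0 (sval x)) Bot (th y) by apply: shadow_crit xy'.
  have [D [D' [DD' xD D'b yD]]] :=
    shadow_rhd_true xm ym' bP xyc ya (proj1 (mframe_mem0 _ abP) xab).
  apply: (jump D D') => //.
  + by apply: boxes_le_trans (mvalid_boxes yv) _; apply: yD.
  + right; split; last exact: yD.
    by move=> u c g h uy uE; apply: nou; exists c, u => //; exists g, h.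
- move=> x a b aP bP xab; have xm := mvalid_mcs1 (svalP x).
  have [D [D' [DD' xD D'a]]] := shadow_rhd_false xm aP xab.
  have [y [xy yE ya]] := mframe_succ a DD' xD.
  exists y; split=> //; first by rewrite ya.
  move=> z yz xz /(mframe_mem0 _ bP).
  have uz : prefix j5 (Succ (sval x) b D D') (sval z) by rewrite -yE.
  (* A [b]-critical set cannot contain [b], as [b] interprets itself. *)
  by apply: (block_crit (svalP z) uz xz); apply: mcs_rhd_L => //; taut.
Qed.

Lemma mframe_counterexample a : {subset subformulas a <= Phi} -> ~ h0 a ->
  exists F : bitop_space,
    [/\ CL `<=` Log F, Log F axM, j5 -> Log F axJ5 & ~ Log F a].
Proof.
move=> aPhi h0a; exists (frame_space x0 R S); split.
- apply: (frame_CL mframe_trans mframe_succs _ mframe_refl mframe_Strans).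
  by move=> x; apply: leq_trans (succs_rank (svalP x)) (rank_bound _).
- exact: (frame_M mframe_trans mframe_succs mframe_refl mframe_Strans mframe_M).
- move=> j.
  apply: (frame_J5 mframe_trans mframe_succs mframe_refl mframe_Strans).
  by move=> x y; apply: mframe_J5.
- by move=> /LogP Fa; apply: h0a; apply/(mframe_truth aPhi x0); apply: Fa.
Qed.

End Counterexample.
End MFrame.

(** * Counterexamples validating J5, P or W *)

(* AnyJump serves CL and IL; jumps to the immediate predecessor only, for P;
   jumps that record the antecedent a by making the new node critical for
   [Or c0 (Dia a)], for W. *)
Inductive jump_policy := AnyJump | NearJump | RecordJump.

Section Chain.
Variable k : jump_policy.

(* [label q z d]: the node z is a d-critical successor of q. *)
Fixpoint label q z d : Prop :=
  match z with
  | Root _ _ => False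
  | Succ y c _ _ => q = y /\ d = c \/
      exists2 d', label q y d' & d = if j5 then d' else Bot
  | Jump y p c _ _ => q = p /\ d = c \/
      exists2 d', label q p d' & d = if j5 then d' else Bot
  end.

Definition may_jump y p c : Prop :=
  exists2 c0, label p y c0 &
    match k with
    | AnyJump => c = c0
    | NearJump => c = c0 /\ level y = Some p
    | RecordJump => exists a, [/\ a \in Phi, th1 y a & c = Or c0 (Dia a)]
    end.

Fixpoint valid z : Prop :=
  match z with
  | Root g h => shadow g h
  | Succ y c g h => [/\ valid y, shadow g h & crit (th1 y) c g]
  | Jump y p c g h =>
      [/\ valid y, valid p, may_jump y p c, shadow g h & crit (th1 p) c g]
  end.

Lemma valid_shadow z : valid z -> shadow (th0 z) (th1 z).
Proof. by case: z => [g h|y c g h|y p c g h] //= []. Qed.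

Lemma valid_mcs0 z : valid z -> mcs (th0 z).
Proof. by move=> /valid_shadow[[]]. Qed.

Lemma valid_mcs1 z : valid z -> mcs (th1 z).
Proof. by move=> /valid_shadow[[]]. Qed.

Lemma may_jump_imp y p c c0 : may_jump y p c ->
  (forall d, label p y d -> L (Imp c0 d)) -> L (Imp c0 c).
Proof.
move=> [c1 yc1 cE] /(_ _ yc1) c01; case: k cE => [->//|[->]//|[a [_ _ ->]]].
by apply: L_mp _ c01; taut.
Qed.

Lemma label_trans q p z d e : label q p d -> label p z e ->
  exists f, label q z f.
Proof.
move=> qp; elim: z e => [g h|y IHy c g h|y _ p' IHp c g h] e //=.
  case=> [[pE _]|[e' /IHy[f qy] _]].
    by exists (if j5 then d else Bot); right; exists d; rewrite -?pE.
  by exists (if j5 then f else Bot); right; exists f.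
case=> [[pE _]|[e' /IHp[f qp'] _]].
  by exists (if j5 then d else Bot); right; exists d; rewrite -?pE.
by exists (if j5 then f else Bot); right; exists f.
Qed.

Lemma label_prefix q z d : valid z -> label q z d -> prefix true q z.
Proof.
elim: z q d => [g h|y IHy c g h|y IHy p IHp c g h] q d //=.
  move=> [yv _ _] [[-> _]|[d' /(IHy _ _ yv) qy _]]; right; split=> //.
  exact: prefix_refl.
move=> [yv pv [c0 yc0 _] _ _] qz; right; have py := IHy _ _ yv yc0.
by case: qz => [[-> _]//|[d' /(IHp _ _ pv) qp _]]; apply: prefix_trans py.
Qed.

Lemma label_len q z d : valid z -> label q z d -> len q < len z.
Proof.
case: z => [g h|y c g h|y p c g h] //=.
  move=> [yv _ _] [[-> _]//|[d' /(label_prefix yv) /prefix_len qy _]].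
  by rewrite ltnS.
move=> [yv pv [c0 /(label_prefix yv) /prefix_len py _] _ _]; rewrite ltnS.
case=> [[-> _]//|[d' /(label_prefix pv) /prefix_len qp _]].
exact: leq_trans py.
Qed.

Lemma label_level q z d : valid z -> label q z d ->
  exists p e, [/\ valid p, level z = Some p, label p z e
                & q = p \/ exists d', label q p d'].
Proof.
case: z => [g h|y c g h|y p c g h] //= zv qz.
  exists y, c; split=> //; [by case: zv | by left |].
  by case: qz => [[-> _]|[d' ? _]]; [left | right; exists d'].
exists p, c; split=> //; [by case: zv | by left |].
by case: qz => [[-> _]|[d' ? _]]; [left | right; exists d'].
Qed.

Lemma label_succ_refl q c g h d : valid (Succ q c g h) ->
  label q (Succ q c g h) d -> d = c.
Proof.
by move=> [qv _ _] /= [[_ ->]//|[d' /(label_len qv)]]; rewrite ltnn.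
Qed.

(** With J5, [Rhd b d] in [G] puts [Box (Neg b)] into [D], and so [Neg b] into [E]. Without J5 only
    plain accessibility is transitive, which is [Bot]-criticality. *)
Lemma crit_compose G d D D' c E : mcs G -> mcs E -> shadow D D' ->
  crit G d D -> crit D' c E -> crit G (if j5 then d else Bot) E.
Proof.
move=> Gm Em DD' GD D'E; have [[Dm D'm _ _] [_ DE]] := DD'.
case: ifP => j.
  move=> b /(crit_J5 (J5_L j) Gm Dm GD) /(shadow_box DD').
  by case/(crit_box D'm Em D'E) => /(mcs_neg Em).
apply: crit_botP => // a /(crit_box Gm Dm GD)[_] /(shadow_box DD').
by move=> /(crit_box D'm Em D'E)[].
Qed.

Lemma label_crit q z d : valid q -> valid z -> label q z d ->
  crit (th1 q) d (th0 z).
Proof.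
move=> qv; have qm := valid_mcs1 qv.
elim: z d => [g h|y IHy c g h|y _ p IHp c g h] d //= zv h'.
  have [yv [[gm _ _ _] _] yg] := zv.
  case: h' => [[-> ->]//|[d' qy ->]].
  exact: crit_compose (valid_shadow yv) (IHy _ yv qy) yg.
have [_ pv _ [[gm _ _ _] _] pg] := zv.
case: h' => [[-> ->]//|[d' qp ->]].
exact: crit_compose (valid_shadow pv) (IHp _ pv qp) pg.
Qed.

Lemma label_rank q z d : valid q -> valid z -> label q z d ->
  rank (th1 q) < rank (th1 z).
Proof.
move=> qv zv /(label_crit qv zv) qz; have zz := valid_shadow zv.
case: (zz) => -[zm _ bb gd] _.
exact: rank_lt (valid_mcs1 qv) zm qz bb gd (fun d => shadow_box zz).
Qed.

Lemma chain_block_level q c g h y p e : valid y ->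
  prefix false (Succ q c g h) y -> label p y e -> len p <= len q.
Proof.
elim: y p e => [g' h'|y IHy c' g' h'|y IHy p' _ c' g' h'] p e // yv [uy|uy] //.
- case: uy => -> _ _ _; case: yv => yv _ _.
  by case=> [[-> _]//|[d' /(label_len yv) /ltnW]].
- by case: uy.
- case: yv => yv pv [c0 yc0 _] _ _ h'0.
  have qp' := IHy _ _ yv uy yc0.
  case: h'0 => [[-> _]//|[d' /(label_len pv) /ltnW pp' _]].
  exact: leq_trans qp'.
Qed.

(** The counterpart of [block_crit] for labels: returning to [q] can only weaken the label. A jump
    to a node above [q] needs J5, and then that node also prolongs [u]. *)
Lemma chain_block_label q c g h z d : valid z ->
  prefix j5 (Succ q c g h) z -> label q z d -> L (Imp c d).
Proof.
set u := Succ q c g h.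
elim: z d => [g' h'|y IHy c' g' h'|y IHy p IHp c' g' h'] d zv uz qz.
- by [].
- case: uz => [uE|[j uy]].
    have uv : valid u by rewrite uE.
    have -> : d = c by apply: (label_succ_refl uv); rewrite -/u uE.
    by taut.
  case: zv => yv _ _; case: qz => [[qE _]|[d' qy ->]].
    by have := prefix_len uy; rewrite -qE /= ltnn.
  by rewrite j; apply: IHy qy.
case: uz => [//|uy].
case: (zv) => yv pv yp _ _; case: qz => [[qE ->]|[d' qp ->]].
  apply: may_jump_imp yp _ => e; rewrite -qE; exact: IHy.
have lqp := label_len pv qp.
case: (yp) => c0 yc0 _.
have [j|nj] := boolP j5; last first.
  move: uy; rewrite (negbTE nj) => uy.
  by have := chain_block_level yv uy yc0; rewrite leqNgt lqp.
apply: IHp qp => //.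
exact: prefix_compare (label_prefix yv yc0) uy _.
Qed.

(** * A bounded measure for W that never decreases along prolongation *)

Section JumpMeasure.
Hypothesis j5_true : j5.
Hypothesis k_record : k = RecordJump.

Definition recorded c : pred 'I_(size Phi) :=
  fun i => `[< L (Imp (Dia (nth Bot Phi i)) c) >].
Definition records c : nat := #|recorded c|.

Fixpoint depth z : nat :=
  match z with
  | Root _ _ => 0
  | Succ y _ _ _ => (depth y).+1
  | Jump _ p _ _ _ => (depth p).+1
  end.

(** A digit is a number of records plus one, so it lies between 1 and [(size Phi).+1]; being
    positive, it makes each [R]-step increase the measure. *)
Let base := (size Phi).+2.
Let max_depth := 2 ^ size Phi.

(** The room left for the digits after [z]: a bound on what its descendants can add to the
    measure. *)
Definition weight z : nat := base ^ (max_depth.+1 - depth z).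

Definition cell p c : nat := (records c).+1 * base ^ (max_depth - depth p).

(* The records along the ancestors of a node, read as the digits of a number
   in base [base], the root's being the most significant one: a jump back to
   an ancestor [p] increases the digit of [p] and discards the later ones. *)
Fixpoint measure z : nat :=
  match z with
  | Root _ _ => 0
  | Succ y c _ _ => measure y + cell y c
  | Jump _ p c _ _ => measure p + cell p c
  end.

Lemma records_le c d : L (Imp c d) -> records c <= records d.
Proof.
move=> cd; apply: subset_leq_card; apply/fintype.subsetP => i.
by rewrite !unfold_in => /asboolP ic; apply/asboolP; apply: L_trans ic cd.
Qed.

Lemma records_lt c a : a \in Phi -> ~ L (Imp (Dia a) c) ->
  records c < records (Or c (Dia a)).
Proof.
move=> aPhi ac; apply: proper_card; apply/fintype.properP; split.
  apply/fintype.subsetP => i; rewrite !unfold_in => /asboolP ic; apply/asboolP.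
  by apply: L_trans ic _; taut.
have ia : index a Phi < size Phi by rewrite index_mem.
exists (Ordinal ia); rewrite unfold_in /= nth_index //; last exact/asboolP.
by apply/asboolP; taut.
Qed.

Lemma records_bound c : records c <= size Phi.
Proof. by rewrite -[leqRHS]card_ord max_card. Qed.

Lemma cell_gt0 p c : 0 < cell p c.
Proof. by rewrite muln_gt0 expn_gt0. Qed.

Lemma depth_rank z : valid z -> depth z <= rank (th1 z).
Proof.
elim: z => [g h|y IHy c g h|y _ p IHp c g h] zv //.
  case: (zv) => yv _ _; apply: leq_ltn_trans (IHy yv) _.
  by apply: label_rank zv _ => //; left.
case: (zv) => _ pv _ _ _; apply: leq_ltn_trans (IHp pv) _.
by apply: label_rank zv _ => //; left.
Qed.

Lemma depth_bound z : valid z -> depth z <= max_depth.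
Proof. by move=> /depth_rank dz; apply: leq_trans dz (rank_bound _). Qed.

Lemma weight_child p c : valid p ->
  cell p c + base ^ (max_depth - depth p) <= weight p.
Proof.
move=> /depth_bound dp; rewrite /weight subSn // expnS /cell -mulSnr.
by rewrite leq_mul2r !ltnS records_bound orbT.
Qed.

Lemma measure_bound z : valid z -> measure z + weight z <= base ^ max_depth.+1.
Proof.
elim: z => [g h|y IHy c g h|y _ p IHp c g h] zv.
- by rewrite add0n /weight subn0.
- case: zv => yv _ _; apply: leq_trans (IHy yv).
  by rewrite /= -addnA leq_add2l /weight /= subSS weight_child.
- case: zv => _ pv _ _ _; apply: leq_trans (IHp pv).
  by rewrite /= -addnA leq_add2l /weight /= subSS weight_child.
Qed.

Lemma measure_label q z d : label q z d -> measure q < measure z.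
Proof.
elim: z d => [g h|y IHy c g h|y _ p IHp c g h] d //=.
  case=> [[-> _]|[d' /IHy qy _]]; first by rewrite -addn1 leq_add2l cell_gt0.
  exact: leq_trans qy (leq_addr _ _).
case=> [[-> _]|[d' /IHp qp _]]; first by rewrite -addn1 leq_add2l cell_gt0.
exact: leq_trans qp (leq_addr _ _).
Qed.

(** With J5 the label of [z] seen from [p] is that of the first step above [p], so it determines the
    digit of [p]; later digits stay within one unit of that place. *)
Lemma measure_digit p z d : valid z -> label p z d ->
  measure z + weight z <=
    measure p + (cell p d + base ^ (max_depth - depth p)).
Proof.
elim: z d => [g h|y IHy c g h|y _ p' IHp c g h] d zv //=.
- case: zv => yv _ _; case=> [[-> ->]|[d' py ->]].
    by rewrite -addnA /weight /= subSS.
  rewrite j5_true; apply: leq_trans (IHy _ yv py).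
  by rewrite -addnA leq_add2l {1}/weight /= subSS weight_child.
- case: zv => _ pv _ _ _; case=> [[-> ->]|[d' pp' ->]].
    by rewrite -addnA /weight /= subSS.
  rewrite j5_true; apply: leq_trans (IHp _ pv pp').
  by rewrite -addnA leq_add2l {1}/weight /= subSS weight_child.
Qed.

(** If [p] is the immediate predecessor of [y], only the last digit changes, and it does not
    decrease. Otherwise the digit of [p] strictly increases, which outweighs the digits dropped. *)
Lemma measure_jump y p c g h : valid (Jump y p c g h) ->
  measure y <= measure (Jump y p c g h).
Proof.
move=> [yv pv [c0 yc0]]; rewrite k_record => -[a [aP ya ->]] _ _ /=.
have [p' [e [p'v yp' p'y pp']]] := label_level yv yc0.
have cc0 : records c0 <= records (Or c0 (Dia a)) by apply: records_le; taut.
case: pp' => [pE|[d' pp']].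
  suff -> : measure y = measure p + cell p c0.
    by rewrite leq_add2l leq_mul2r ltnS cc0 orbT.
  have lpp : label p p c0 -> False by move=> /(label_len pv); rewrite ltnn.
  rewrite -pE in yp'.
  case: y yv {ya p'y} yp' yc0 => [//|y c' g' h'|y p1 c' g' h'] yv /= [->].
    by case=> [[_ ->]//|[d' + dE]]; rewrite j5_true in dE; rewrite -dE => /lpp.
  by case=> [[_ ->]//|[d' + dE]]; rewrite j5_true in dE; rewrite -dE => /lpp.
have pp0 : label p p' c0.
  have npp' : p <> p' by move=> pE; move: (label_len p'v pp'); rewrite pE ltnn.
  case: y yv yp' yc0 {ya p'y} => [//|y c' g' h'|y p1 c' g' h'] yv /= [->].
    by case=> [[]//|[d'' + dE]]; rewrite j5_true in dE; rewrite -dE.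
  by case=> [[]//|[d'' + dE]]; rewrite j5_true in dE; rewrite -dE.
(* Had [a] been recorded in [c0] already, the critical node [p'] would omit [Dia a], although [a]
   holds at its successor [y]. *)
have ac0 : ~ L (Imp (Dia a) c0).
  move=> ac0; have pm := valid_mcs1 pv; have p'm := valid_mcs0 p'v.
  have p'a : th0 p' (Box (Neg a)).
    apply: contrapT => /(mcs_neg p'm); apply: (label_crit pv p'v pp0).
    exact: mcs_rhd_L.
  have [ym ym1 yy _] := proj1 (valid_shadow yv).
  have [/(mcs_neg ym)] := crit_box (valid_mcs1 p'v) ym (label_crit p'v yv p'y)
    (shadow_box (valid_shadow p'v) p'a).
  by case; apply/(bits_mem aP yy).
have lt_c0 := records_lt aP ac0.
apply: leq_trans (leq_trans (leq_addr (weight y) _) (measure_digit yv yc0)) _.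
by rewrite leq_add2l /cell -mulSnr leq_mul2r ltnS lt_c0 orbT.
Qed.

Lemma measure_prefix q z : valid z -> prefix true q z -> measure q <= measure z.
Proof.
elim: z => [g h|y IHy c g h|y IHy p _ c g h] zv [->|qz] //.
  case: zv => yv _ _; case: qz => _ qy.
  exact: leq_trans (IHy yv qy) (leq_addr _ _).
by apply: leq_trans (measure_jump zv); case: zv => yv _ _ _ _; apply: IHy.
Qed.

End JumpMeasure.

(** * The frame of histories for logics with no M *)

Section ChainCounterexample.
Variables (g0 h0 : set formula).
Hypothesis root_shadow : shadow g0 h0.
Hypothesis near_P : k = NearJump -> L axP.
Hypothesis record_W : k = RecordJump -> L axW.

Let X := {z | valid z}.
Let x0 : X := exist valid (Root g0 h0) root_shadow.
Let R (x y : X) := exists d, label (sval x) (sval y) d.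
Let S (x y : X) := prefix j5 (sval x) (sval y).
Let th (x : X) := th1 (sval x).

Lemma chain_trans x y z : R x y -> R y z -> R x z.
Proof. by move=> [d xy] [e]; apply: label_trans xy. Qed.

Lemma chain_rank x y : R x y -> rank (th x) < rank (th y).
Proof. by case=> d; apply: label_rank; [exact: svalP | exact: svalP]. Qed.

Lemma chain_refl x : S x x. Proof. exact: prefix_refl. Qed.

Lemma chain_Strans x y z : S x y -> S y z -> S x z.
Proof. exact: prefix_trans. Qed.

Lemma chain_J5 x y : j5 -> R x y -> S x y.
Proof. by move=> j [d /(label_prefix (svalP y))]; rewrite /S j. Qed.

(** A jump that returns only to the immediate predecessor leaves the set of all predecessors
    unchanged. *)
Lemma chain_P x y z : k = NearJump -> R x y -> S y z -> R x z.
Proof.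
move=> kE [d xy] /prefix_weak; case: x y z xy => [x xv] [y yv] [z zv].
rewrite /R /= => xy; elim: z zv => [g h|z IHz c g h|z IHz p _ c g h] zv yz.
- by exists d; case: yz => [<-|].
- case: yz => [<-|[_ yz]]; first by exists d.
  case: (zv) => z'v _ _; have [e xz] := IHz z'v yz.
  by exists (if j5 then e else Bot); right; exists e.
- case: yz => [<-|yz]; first by exists d.
  case: (zv) => z'v pv [c0 _]; rewrite kE => -[_ zp] _ _.
  have [e xz] := IHz z'v yz.
  have [p' [f [_]]] := label_level z'v xz; rewrite zp => -[<-] _ [->|[e' xp]].
    by exists c; left.
  by exists (if j5 then e' else Bot); right; exists e'.
Qed.

Lemma chain_succ x c g h a : shadow g h -> crit (th x) c g ->
  exists y : X, [/\ R x y, sval y = Succ (sval x) c g h & th y a = h a].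
Proof.
move=> gh xg; have yv : valid (Succ (sval x) c g h).
  by split=> //; apply: svalP.
by exists (exist _ _ yv); split=> //; exists c; left.
Qed.

Lemma chain_mem0 x a : a \in Phi -> th x a <-> th0 (sval x) a.
Proof.
move=> aPhi; apply: iff_sym.
exact: shadow_mem (valid_shadow (svalP x)) aPhi.
Qed.

Lemma chain_truth (a : formula) : {subset subformulas a <= Phi} ->
  forall x : X,
  @val (frame_space x0 R S) (fun n x => th x (Var n)) a x <-> th x a.
Proof.
move: a; apply: (@truth X x0 R S (fun x => rank (th x)) chain_trans chain_rank
  chain_refl chain_Strans th).
- by move=> x; apply: valid_mcs1 (svalP x).
- move=> x y a aP bP xa [d xy]; apply/chain_mem0 => //.
  have xm := valid_mcs1 (svalP x); have ym := valid_mcs0 (svalP y).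
  by have [] := crit_box xm ym (label_crit (svalP x) (svalP y) xy) xa.
- move=> x a aP xa; have xm := valid_mcs1 (svalP x).
  have [D [D' [DD' xD D'a]]] := shadow_box_false xm aP xa.
  have [y [xy _ ya]] := chain_succ a DD' xD.
  by exists y => //; rewrite ya.
- move=> x y a b aP bP abP xab [d xy] ya.
  have [xv yv] := (svalP x, svalP y).
  have xm := valid_mcs1 xv.
  have y0a := proj1 (chain_mem0 _ aP) ya.
  have xyd := label_crit xv yv xy.
  have jump p c D D' : valid p -> may_jump (sval y) p c -> shadow D D' ->
      crit (th1 p) c D -> D' b ->
      (exists e, label (sval x) (Jump (sval y) p c D D') e) ->
      exists z, [/\ S y z, R x z & th z b].
    move=> pv yp DD' pD D'b xz.
    have zv : valid (Jump (sval y) p c D D') by split.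
    by exists (exist _ _ zv); split=> //; apply: prefix_jump.
  case kE : k.
  (* [AnyJump]: return to [x] itself and keep the label [d]. *)
  + have [D [D' [DD' xD D'b _]]] :=
      shadow_rhd_true xm (valid_mcs0 yv) bP xyd y0a xab.
    apply: (jump (sval x) d D D') => //; last by exists d; left.
    by exists d => //; rewrite kE.
  (* [NearJump]: axiom P carries [Rhd a b] from [x] up to the immediate predecessor [p] of [y], so
     the jump can return there. *)
  + have [p [e [pv yp py xp]]] := label_level yv xy.
    have pm := valid_mcs1 pv.
    have pab : th1 p (Rhd a b).
      case: xp => [<-//|[d' xp]].
      have /(crit_box xm (valid_mcs0 pv) (label_crit xv pv xp))[+ _] :
          th x (Box (Rhd a b)).
        by apply: mcs_sub xab => //; apply: L_P; apply: near_P.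
      move=> /(bits_mem (D' := th1 p) abP); apply.
      by case: (valid_shadow pv) => -[].
    have [D [D' [DD' pD D'b _]]] :=
      shadow_rhd_true pm (valid_mcs0 yv) bP (label_crit pv yv py) y0a pab.
    apply: (jump p e D D') => //; first by exists e => //; rewrite kE.
    case: xp => [->|[d' xp]]; first by exists e; left.
    by exists (if j5 then d' else Bot); right; exists d'.
  (* [RecordJump]: return to [x] and record [a] in the label, as W permits. *)
  + have [D [D' [DD' xD D'b]]] :=
      shadow_rhd_W (record_W kE) xm bP xyd y0a xab.
    apply: (jump (sval x) (Or d (Dia a)) D D') => //; last first.
      by exists (Or d (Dia a)); left.
    by exists d => //; rewrite kE; exists a.
- move=> x a b aP bP xab; have xm := valid_mcs1 (svalP x).
  have [D [D' [DD' xD D'a]]] := shadow_rhd_false xm aP xab.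
  have [y [xy yE ya]] := chain_succ a DD' xD.
  exists y; split=> //; first by rewrite ya.
  move=> z yz [d xz] /(chain_mem0 _ bP).
  have uz : prefix j5 (Succ (sval x) b D D') (sval z) by rewrite -yE.
  apply: (label_crit (svalP x) (svalP z) xz); apply: mcs_rhd_L => //.
  exact: (chain_block_label (svalP z) uz xz).
Qed.

Lemma chain_counterexample a : {subset subformulas a <= Phi} -> ~ h0 a ->
  exists F : bitop_space,
    [/\ CL `<=` Log F, j5 -> Log F axJ5, k = NearJump -> Log F axP,
        j5 -> k = RecordJump -> Log F axW & ~ Log F a].
Proof.
move=> aPhi h0a; exists (frame_space x0 R S); split.
- apply: (frame_CL chain_trans chain_rank _ chain_refl chain_Strans).
  by move=> x; apply: rank_bound.
- move=> j; apply: (frame_J5 chain_trans chain_rank chain_refl chain_Strans).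
  by move=> x y; apply: chain_J5.
- move=> kE; apply: (frame_P chain_trans chain_rank chain_refl chain_Strans).
  by move=> x y z; apply: chain_P.
- move=> j kE; apply: (frame_W chain_trans chain_rank chain_refl chain_Strans
    (m := fun x => measure (sval x)) (n := (size Phi).+2 ^ (2 ^ size Phi).+1)).
  + by move=> x y; apply: chain_J5.
  + move=> x; apply: leq_trans (measure_bound (svalP x)); exact: leq_addr.
  + by move=> x y /prefix_weak; apply: measure_prefix (svalP y).
  + by move=> x y [d]; apply: measure_label.
- by move=> /LogP Fa; apply: h0a; apply/(chain_truth aPhi x0); apply: Fa.
Qed.

End ChainCounterexample.
End Chain.
End Shadow.
End Types.
End Logic.

(** * Normality of the logics and the choice of a frame for each *)

Lemma add_axiom_self (L : set formula) c : add_axiom L c c.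
Proof. by apply: sub_gen_smallest; right. Qed.

Lemma add_axiom_sub (L : set formula) c : L `<=` add_axiom L c.
Proof. by move=> a La; apply: sub_gen_smallest; left. Qed.

Lemma add_axiom_normal (L : set formula) c : normal_extension (add_axiom L c).
Proof.
split; [|split].
- by move=> a CLa M [[CLM _] _]; apply: CLM.
- move=> a b ab La M MP; have [[_ [mp _ _]] _] := MP.
  by apply: mp (ab M MP) (La M MP).
- by move=> a La M MP; have [[_ [_ nec _]] _] := MP; apply/nec/(La M MP).
- by move=> s a La M MP; have [[_ [_ _ sub]] _] := MP; apply/sub/(La M MP).
Qed.

Lemma CL_normal : normal_extension CL.
Proof.
split=> //; split.
- move=> a b ab La M MP; have [[mp _ _] _] := MP.
  exact: mp (ab M MP) (La M MP).
- by move=> a La M MP; have [[_ nec _] _] := MP; apply/nec/(La M MP).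
- by move=> s a La M MP; have [[_ _ sub] _] := MP; apply/sub/(La M MP).
Qed.

Lemma mframe_complete (L : set formula) (j5 : bool) :
  normal_extension L -> L axM -> (j5 -> L axJ5) ->
  (forall F, CL `<=` Log F -> Log F axM -> (j5 -> Log F axJ5) ->
     L `<=` Log F) ->
  top_complete L.
Proof.
move=> [CLL Lr] LM LJ5 LF a av; apply: contrapT => La.
have aPhi : a \in subformulas a by case: {av La} a => *; rewrite inE eqxx.
have [g [h [gh ha]]] := root_exists CLL Lr j5 aPhi La.
have [F [F1 F2 F3 Fa]] := mframe_counterexample CLL Lr LJ5
  (m := true) (fun _ => LM) isT gh (fun _ => id) ha.
by apply: Fa; apply: av; apply: LF.
Qed.

Lemma chain_complete (L : set formula) (j5 : bool) (k : jump_policy) :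
  normal_extension L -> (j5 -> L axJ5) ->
  (k = NearJump -> L axP) -> (k = RecordJump -> L axW) ->
  (forall F, CL `<=` Log F -> (j5 -> Log F axJ5) ->
     (k = NearJump -> Log F axP) -> (j5 -> k = RecordJump -> Log F axW) ->
     L `<=` Log F) ->
  top_complete L.
Proof.
move=> [CLL Lr] LJ5 LP LW LF a av; apply: contrapT => La.
have aPhi : a \in subformulas a by case: {av La} a => *; rewrite inE eqxx.
have [g [h [gh ha]]] := root_exists CLL Lr j5 aPhi La.
have [F [F1 F2 F3 F4 Fa]] := chain_counterexample CLL Lr LJ5
  (m := false) (fun f => False_ind _ (notF f)) gh LP LW (fun _ => id) ha.
by apply: Fa; apply: av; apply: LF.
Qed.

Theorem theorem3p10 :
  top_complete CL /\ top_complete CLM /\ top_complete IL /\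
  top_complete ILM /\ top_complete ILP /\ top_complete ILW.
Proof.
have nIL := add_axiom_normal CL axJ5.
have JIL c : add_axiom IL c axJ5.
  by apply: (@add_axiom_sub IL); apply: (@add_axiom_self CL).
repeat split.
- by apply: (@chain_complete _ false AnyJump CL_normal).
- apply: (@mframe_complete _ false (add_axiom_normal _ _)) => //.
    exact: add_axiom_self.
  by move=> F F1 F2 _; apply: Log_add_axiom.
- apply: (@chain_complete _ true AnyJump nIL) => //.
    by move=> _; apply: add_axiom_self.
  by move=> F F1 /(_ isT) F2 _ _; apply: Log_add_axiom.
- apply: (@mframe_complete _ true (add_axiom_normal _ _)) => //.
    exact: add_axiom_self.
  move=> F F1 F2 /(_ isT) F3; apply: Log_add_axiom => //.
  exact: Log_add_axiom.
- apply: (@chain_complete _ true NearJump (add_axiom_normal _ _)) => //.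
    by move=> _; apply: add_axiom_self.
  move=> F F1 /(_ isT) F2 /(_ erefl) F3 _; apply: Log_add_axiom => //.
  exact: Log_add_axiom.
- apply: (@chain_complete _ true RecordJump (add_axiom_normal _ _)) => //.
    by move=> _; apply: add_axiom_self.
  move=> F F1 /(_ isT) F2 _ /(_ isT erefl) F3; apply: Log_add_axiom => //.
  exact: Log_add_axiom.
Qed.
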